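(* Let $\Gamma \curvearrowright Y$ be a continuous action of a finitely generated group $\Gamma$ on a compact metric space $(Y,d_Y)$ of diameter at most $2$, and let $\mathcal{O}_{\Gamma}Y$ be the associated warped cone. 1. Assume the action is free and linearizable in a Hilbert space. If $\Gamma$ is uniformly bounded a-T-menable, then $\mathcal{O}_{\Gamma}Y$ admits a uniformly bounded fibred coarse embedding into Hilbert space. 2. Assume the action admits an invariant Borel probability measure $\mu$ on $Y$ and is essentially free with respect to $\mu$. If $\mathcal{O}_{\Gamma}Y$ admits a uniformly bounded fibred coarse embedding into Hilbert space, then $\Gamma$ is uniformly bounded a-T-menable.
   Context: **Affine maps.** An affine map between Hilbert spaces is a map $\psi(h)=T(h)+x$ with $T$ linear and $x$ a fixed vector; its norm $\|\psi\|$ is defined to be the operator norm $\|T\|$ of its linear part. It is an affine isomorphism if it has an inverse that is an affine map. $\mathrm{Affine}(H)$ denotes the group of affine isomorphisms of $H$ onto itself. An affine action of a group on $H$ is a homomorphism to $\mathrm{Affine}(H)$. **Uniformly bounded a-T-menability.** A finitely generated (discrete) group $\Gamma$ is uniformly bounded a-T-menable if there exist a separable Hilbert space $H$ and an affine action $\alpha:\Gamma\to \mathrm{Affine}(H)$ such that (i) there is a constant $L>0$ with $\|\alpha_\gamma\|\le L$ for all $\gamma\in\Gamma$; (ii) $\alpha$ is metrically proper: for every bounded subset $B\subset H$ the set $\{\gamma\in\Gamma:\alpha_\gamma(B)\cap B\ne\emptyset\}$ is finite. **Warped metric.** Let $(X,d)$ be a metric space and $\Gamma$ a group with a finite symmetric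 generating set $S$ acting on $X$ by homeomorphisms. The warped metric $d_\Gamma$ is the greatest metric on $X$ satisfying $d_\Gamma(x,x')\le d(x,x')$ and $d_\Gamma(x,sx)\le 1$ for all $x,x'\in X$, $s\in S$. (Different generating sets give coarsely equivalent warped metrics.) **Warped cone.** The cone of $Y$ is $\mathcal{O}Y=[1,\infty)\times Y$ with the metric $d((t,y),(t',y'))=|t-t'|+\min\{t,t'\}\, d_Y(y,y')$. The warped cone $\mathcal{O}_\Gamma Y$ is $\mathcal{O}Y$ equipped with the warped metric $d_\Gamma$ for the action $\gamma(t,y)=(t,\gamma y)$. **Linearizable.** The action $\Gamma\curvearrowright Y$ is linearizable in a Banach space $E$ if there exist an isometric representation of $\Gamma$ on $E$ and a bi-Lipschitz $\Gamma$-equivariant embedding $Y\to E$. **Essentially free.** An action of a group $G$ on a measure space $(X,\mu)$ is essentially free if $\mu(X_0)=0$, where $X_0$ is the set of $x\in X$ such that $gx=x$ for some non-identity $g\in G$. **Uniformly bounded fibred coarse embedding.** Let $H$ be a separable Hilbert space (the model space). A metric space $(X,d)$ admits a uniformly bounded fibred coarse embedding into Hilbert space if there exist a constant $L>0$ and - a field (i.e. family) of Hilbert spaces $(H_x)_{x\in X}$ over $X$; - a section $s:X\to\bigsqcup_{x\in X}H_x$, i.e. $s(x)\in H_x$; - two non-decreasing functions $\rho_-,\rho_+:[0,\infty)\to(-\infty,\infty)$ with $\lim_{t\to\infty}\rho_\pm(t)=\infty$; such that for any $r>0$ there exists a bounded subset $K\subset X$ for which there exists, for each subset $C\subset X\setminus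 K$ of diameter less than $r$, a trivialization $t_C:(H_x)_{x\in C}\to C\times H$, i.e. a map whose restriction to each fiber $H_x$, $x\in C$, is an affine isomorphism $t_C(x):H_x\to H$ with $\max\{\|t_C(x)\|,\|t_C(x)^{-1}\|\}\le L$, satisfying 1. $\rho_-(d(x,y))\le\|t_C(x)(s(x))-t_C(y)(s(y))\|\le\rho_+(d(x,y))$ for any $x,y\in C$; 2. for any two subsets $C_1,C_2\subset X\setminus K$ of diameter less than $r$ with $C_1\cap C_2\ne\emptyset$, there exists an affine isomorphism $t_{C_1C_2}$ on $H$ with $\max\{\|t_{C_1C_2}\|,\|t_{C_1C_2}^{-1}\|\}$ at most $L$ such that $t_{C_1}(x)t_{C_2}(x)^{-1}=t_{C_1C_2}$ for all $x\in C_1\cap C_2$. *)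

(* Defs.v *)
From HB Require Import structures.
From mathcomp Require Import all_boot all_order all_algebra.
From mathcomp Require Import all_classical all_reals all_analysis.
From mathcomp Require Import lra.

Set Implicit Arguments.
Unset Strict Implicit.
Unset Printing Implicit Defensive.

Import Order.TTheory GRing.Theory Num.Theory.
Import numFieldNormedType.Exports.

Local Open Scope classical_set_scope.
Local Open Scope ring_scope.

(* Hilbert spaces are real; finite-dimensional and zero spaces are allowed. *)
HB.mixin Record isHilbert (R : realType) (H : Type)
    of CompleteNormedModule R H := {
  inner : H -> H -> R ;
  innerC : forall x y, inner x y = inner y x ;
  innerDl : forall x y z, inner (x + y) z = inner x z + inner y z ;
  innerZl : forall (a : R) x y, inner (a *: x) y = a * inner x y ;
  norm_inner : forall x, `|x| ^+ 2 = inner x x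
}.

#[short(type="hilbertType")]
HB.structure Definition Hilbert (R : realType) :=
  { H of isHilbert R H & CompleteNormedModule R H }.

Definition separable (T : topologicalType) : Prop :=
  exists D : set T, countable D /\ dense D.

Section affine.
Context {R : realType}.
Implicit Types V W : normedModType R.

(* Equal to +oo when [T] is unbounded. *)
Definition opnorm V W (T : {linear V -> W}) : \bar R :=
  ereal_sup [set `|T h|%:E | h in [set h | `|h| <= 1]].

Record affine V W := Affine {
  affine_lin : {linear V -> W} ;
  affine_shift : W
}.

Definition affine_fun V W (psi : affine V W) (h : V) : W :=
  affine_lin psi h + affine_shift psi.
Coercion affine_fun : affine >-> Funclass.

Definition affine_norm V W (psi : affine V W) : \bar R :=
  opnorm (affine_lin psi).

Record affine_iso V W := AffineIso {
  affine_fwd :> affine V W ;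
  affine_inv : affine W V ;
  affine_fwdK : cancel affine_fwd affine_inv ;
  affine_invK : cancel affine_inv affine_fwd
}.

Definition affine_iso_bounded V W (L : R) (psi : affine_iso V W) : Prop :=
  (maxe (affine_norm psi) (affine_norm (affine_inv psi)) <= L%:E)%E.

End affine.

Section groups.
Context {G : groupType}.

Definition symmetric_generating (S : seq G) : Prop :=
  (forall s, s \in S -> (s^-1)%g \in S) /\
  (forall g, exists w : seq G, {subset w <= S} /\ g = (\prod_(s <- w) s)%g).

Definition is_action (X : Type) (act : G -> X -> X) : Prop :=
  (forall x, act 1%g x = x) /\
  (forall g h x, act (g * h)%g x = act g (act h x)).

Definition free_action (X : Type) (act : G -> X -> X) : Prop :=
  forall g x, act g x = x -> g = 1%g.

Definition essentially_free (R : realType) (X : Type) (mu : set X -> \bar R)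
    (act : G -> X -> X) : Prop :=
  mu [set x | exists2 g, g != 1%g & act g x = x] = 0%E.

Definition isometric_representation (R : realType)
    (E : completeNormedModType R) (pi : G -> {linear E -> E}) : Prop :=
  is_action (fun g v => pi g v) /\ (forall g v, `|pi g v| = `|v|).

Definition linearizable (R : realType) (Y : metricType R) (act : G -> Y -> Y)
    (E : completeNormedModType R) : Prop :=
  exists (pi : G -> {linear E -> E}) (f : Y -> E) (c C : R),
    [/\ isometric_representation pi,
        0 < c,
        forall y y', c * mdist y y' <= `|f y - f y'| <= C * mdist y y' &
        forall g y, f (act g y) = pi g (f y)].

End groups.

Definition ub_aTmenable (R : realType) (G : groupType) : Prop :=
  exists (H : hilbertType R) (alpha : G -> affine_iso H H),
    [/\ separable H,
        forall g h v, alpha (g * h)%g v = alpha g (alpha h v),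
        exists2 L : R, 0 < L & forall g, (affine_norm (alpha g) <= L%:E)%E &
        forall B : set H, bounded_set B ->
          finite_set [set g | (alpha g @` B) `&` B !=set0]].

Section metrics.
Context {R : realType} {X : Type}.
Implicit Types d : X -> X -> R.

Definition is_metric d : Prop :=
  [/\ forall x y, 0 <= d x y,
      forall x y, d x y = 0 <-> x = y,
      forall x y, d x y = d y x &
      forall x y z, d x z <= d x y + d y z].

(* The diameter of the empty set is -oo. *)
Definition diam d (C : set X) : \bar R :=
  ereal_sup [set (d p.1 p.2)%:E | p in C `*` C].

Section warped.
Context {G : groupType} (d : X -> X -> R) (act : G -> X -> X) (S : seq G).

Definition warped_candidate (d' : X -> X -> R) : Prop :=
  [/\ is_metric d',
      forall x x', d' x x' <= d x x' &
      forall x s, s \in S -> d' x (act s x) <= 1].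

Definition is_warped_metric (dG : X -> X -> R) : Prop :=
  warped_candidate dG /\
  forall d', warped_candidate d' -> forall x x', d' x x' <= dG x x'.

Definition warped_dist (x x' : X) : R :=
  sup [set d' x x' | d' in warped_candidate].

Lemma warped_candidate_min1 :
  is_metric d -> warped_candidate (fun x y => Num.min 1 (d x y)).
Proof.
case=> d0 dE dC dT; split; first split.
- by move=> x y; rewrite le_min ler01 d0.
- move=> x y; rewrite -dE; split=> [|->].
    by rewrite minEle; case: ifP => // _ /eqP; rewrite oner_eq0.
  by rewrite (min_idPr _).
- by move=> x y; rewrite dC.
- move=> x y z; have := dT x y z; have := d0 x y; have := d0 y z.
  by rewrite !minEle; do !case: ifPn; rewrite -?ltNge => *; lra.
- by move=> x x'; rewrite ge_min lexx orbT.
- by move=> x s _; rewrite ge_min lexx.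
Qed.

Lemma warped_distP : is_metric d -> is_warped_metric warped_dist.
Proof.
move=> dm; have m1 := warped_candidate_min1 dm.
have ub x x' : ubound [set d' x x' | d' in warped_candidate] (d x x').
  by move=> _ [d' [_ + _] <-]; apply.
have ne x x' : [set d' x x' | d' in warped_candidate] !=set0.
  by exists (Num.min 1 (d x x')), (fun x y => Num.min 1 (d x y)).
have le d' x x' : warped_candidate d' -> d' x x' <= warped_dist x x'.
  move=> cd'; apply: ub_le_sup; first by exists (d x x').
  by exists d'.
split; last by move=> d' cd' x x'; exact: le.
split; [split|by move=> x x'; exact: ge_sup|].
- move=> x y; apply: le_trans (le _ x y m1).
  by case: m1 => -[].
- move=> x y; split=> [xy|->].
    have [[p0 pE _ _] _ _] := m1; apply/pE/eqP.
    rewrite eq_le p0 andbT -[leRHS]xy; exact: le m1.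
  apply/eqP; rewrite eq_le; apply/andP; split.
    by apply: ge_sup => // _ [d' [[_ dE _ _] _ _] <-]; rewrite (proj2 (dE y y)).
  by apply: le_trans (le _ y y m1); case: m1 => -[].
- move=> x y; congr sup; apply/seteqP.
  by split=> _ [d' cd' <-]; exists d' => //; case: cd' => -[].
- move=> x y z; apply: ge_sup => // _ [d' cd' <-].
  have [[_ _ _ dT] _ _] := cd'.
  by apply: le_trans (dT x y z) _; rewrite lerD// le.
- by move=> x s sS; apply: ge_sup => // _ [d' [_ _ +] <-]; apply.
Qed.

End warped.

Definition small_set d (K : set X) (r : R) :=
  {C : set X | C `<=` ~` K /\ (diam d C < r%:E)%E}.

Definition control_function (rho : R -> R) : Prop :=
  (forall a b, 0 <= a -> a <= b -> rho a <= rho b) /\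
  rho t @[t --> +oo] --> +oo.

(* A trivialization [t C] is only given on the fibres over points of [C], hence
   its proof argument; fibres over points of [K] need not be isomorphic to
   [H]. *)
Definition ub_fibred_coarse_embedding d : Prop :=
  exists (H : hilbertType R) (L : R) (Hx : X -> hilbertType R)
      (s : forall x, Hx x) (rho_m rho_p : R -> R),
    [/\ separable H, 0 < L, control_function rho_m, control_function rho_p &
    forall r : R, 0 < r ->
      exists2 K : set X, (diam d K < +oo)%E &
      exists t : forall (C : small_set d K r) (x : X),
                   sval C x -> affine_iso (Hx x) H,
      [/\ forall C x (Cx : sval C x), affine_iso_bounded L (t C x Cx),
          forall C x y (Cx : sval C x) (Cy : sval C y),
            rho_m (d x y) <= `|t C x Cx (s x) - t C y Cy (s y)| <=
              rho_p (d x y) &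
          forall C1 C2, sval C1 `&` sval C2 !=set0 ->
            exists2 t12 : affine_iso H H, affine_iso_bounded L t12 &
            forall x (C1x : sval C1 x) (C2x : sval C2 x) (h : H),
              t C1 x C1x (affine_inv (t C2 x C2x) h) = t12 h]].

End metrics.

Section cone.
Context {R : realType} {Y : metricType R}.

Definition cone : Type := ({t : R | 1 <= t} * Y)%type.

Definition cone_dist (p q : cone) : R :=
  `|sval p.1 - sval q.1| + Num.min (sval p.1) (sval q.1) * mdist p.2 q.2.

Definition cone_act {G : groupType} (act : G -> Y -> Y) (g : G) (p : cone) :
  cone := (p.1, act g p.2).

(* The bound on the diameter is what makes the triangle inequality hold. *)
Lemma cone_dist_metric :
  (diam (@mdist R Y) setT <= 2%:E)%E -> is_metric cone_dist.
Proof.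
move=> dY; have d2 (x y : Y) : mdist x y <= 2.
  rewrite -lee_fin; apply: le_trans dY; apply: ereal_sup_ubound.
  by exists (x, y).
have min0 (t u : {t : R | 1 <= t}) : 0 < Num.min (sval t) (sval u).
  have s0 (w : {t : R | 1 <= t}) : 0 < sval w.
    by case: w => w /=; exact: lt_le_trans.
  by rewrite lt_min !s0.
have key (t u v a b c : R) : 1 <= t -> 1 <= u -> 0 <= a -> 0 <= b ->
    c <= 2 -> c <= a + b -> t <= v ->
    `|t - v| + t * c <=
    `|t - u| + Num.min t u * a + (`|u - v| + Num.min u v * b).
  move=> t1 u1 a0 b0 c2 cab tv; rewrite (distrC t v) ger0_norm ?subr_ge0//.
  have [ut|tu] := leP u t.
    have uv := le_trans ut tv; rewrite (min_idPl uv) (distrC u v).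
    rewrite (ger0_norm (_ : 0 <= t - u)) ?subr_ge0//.
    rewrite (ger0_norm (_ : 0 <= v - u)) ?subr_ge0//.
    have : u * c <= u * (a + b) by rewrite ler_wpM2l//; lra.
    have : (t - u) * c <= (t - u) * 2 by rewrite ler_wpM2l//; lra.
    by lra.
  have : t * c <= t * (a + b) by rewrite ler_wpM2l//; lra.
  have : t * b <= Num.min u v * b by rewrite ler_wpM2r// le_min tv (ltW tu).
  have := ler_norm (v - u); rewrite (distrC v u).
  have := ler_norm (u - t); rewrite (distrC u t).
  by lra.
rewrite /cone_dist; split.
- by move=> x y; rewrite addr_ge0// mulr_ge0// ?mdist_ge0// ltW.
- move=> [t x] [u y] /=; split=> [/eqP|[-> ->]]; last first.
    by rewrite subrr normr0 mdistxx mulr0 addr0.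
  rewrite paddr_eq0 ?mulr_ge0 ?mdist_ge0 ?(ltW (min0 t u))//.
  rewrite normr_eq0 subr_eq0 mulf_eq0 (gt_eqF (min0 t u))/= => /andP[/eqP tu].
  by move/eqP/mdist_positivity => ->; congr pair; exact: val_inj.
- by move=> x y; rewrite distrC minC metric_sym.
- move=> [[t t1] x] [[u u1] y] [[v v1] z] /=.
  have := metric_triangle x y z; have := d2 x z.
  have := mdist_ge0 x y; have := mdist_ge0 y z; have := mdist_ge0 x z.
  move: (mdist x y) (mdist y z) (mdist x z) => a b c _ b0 a0 c2 cab.
  have [tv|/ltW vt] := leP t v; first exact: key.
  rewrite (distrC t v) (distrC t u) (distrC u v) (minC t u) (minC u v).
  by rewrite [leRHS]addrC; apply: key => //; rewrite addrC.
Qed.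

Definition warped_cone_dist {G : groupType} (act : G -> Y -> Y) (S : seq G) :
    cone -> cone -> R :=
  warped_dist cone_dist (cone_act act) S.

End cone.

(* [measurableType]s are pointed whereas [Y] need not be: a base point is
   supplied explicitly.  It has no influence on the measurable sets. *)
Section borel.
Context {R : realType} {Y : metricType R}.

Definition at_point (y0 : Y) : Type := Y.
HB.instance Definition _ (y0 : Y) := Metric.on (at_point y0).
HB.instance Definition _ (y0 : Y) := isPointed.Build (at_point y0) y0.

Definition borel (y0 : Y) := g_sigma_algebraType (@open (at_point y0)).

Definition invariant_measure {G : groupType} (act : G -> Y -> Y) (y0 : Y)
    (mu : set (borel y0) -> \bar R) : Prop :=
  forall g (A : set (borel y0)), measurable A -> mu (act g @^-1` A) = mu A.

End borel.

(* Main.v *)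
(** Every Hilbert space built here is the completion of a semi-inner product
    space on which the group already acts.

    Part 1.  Take the space [span f(Y) + R + H0] with the action
    [(pi g, id, alpha g)] and the section [s (t, y) = (t f(y), t, 0)].  By
    freeness and compactness, two points of a small set [C] far out in the cone
    are related by a unique short group element, up to a small jump; transporting
    each fibre over [C] to a base point by this element trivializes the field.

    Part 2.  Far out in the cone, at a level [t_n] where sets of diameter
    [2 n + 2] are trivialized, the changes of trivialization between the sets
    [C y = {(t_n, z (h^-1 y)) : |h| <= n}] form a partial action on functions
    [Y -> H], and the section yields a partial cocycle [b_n].  Integrating over
    [Y] and passing to an ultralimit turns the Gram matrices of the [b_n] into a
    semi-inner product on the free vector space on [G], on which the cocycle
    identity defines a uniformly bounded affine action.  It is proper because,
    by essential freeness, for most [y] the points [(t_n, y)] and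
    [(t_n, g^-1 y)] are far apart once [g] is long and [n] is large. *)

Require Import Defs.
From HB Require Import structures.
From mathcomp Require Import all_boot all_order all_algebra.
From mathcomp Require Import all_classical all_reals all_analysis.
From mathcomp Require Import measurable_realfun ring lra.

Set Implicit Arguments.
Unset Strict Implicit.
Unset Printing Implicit Defensive.

Import Order.TTheory GRing.Theory Num.Theory.
Import numFieldNormedType.Exports.

Local Open Scope classical_set_scope.
Local Open Scope ring_scope.

(** * Completions of semi-inner product spaces *)

(** Uniform boundedness replaces isometry, so no inner product is preserved and only norm
    inequalities are available. In Part 2 the change of trivialization at stage [n] and point [y] is
    a linear map of norm at most [L], with no control on its dependence on [y] and no convergence in
    [n]. It is therefore neither integrated nor passed to the limit. It enters only through the
    pointwise bound [|sum_i p_i (b(g e_i) - b(g))(y)| <= L |sum_i p_i b(e_i)(g^-1 y)|]. After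
    squaring and integrating, the translation by [g^-1] disappears by invariance of [mu], and the
    inequality survives the ultralimit. It is exactly what lets the formal action on the free vector
    space descend to the completion with norm at most [L]. Part 1 measures jumps by [|f y - f z|],
    which every group element preserves, so that all moves of a path can be performed before its
    jumps. Freeness enters as a uniform displacement: short nontrivial elements move every point by
    more than some [e], so two short elements with nearly the same effect on a point coincide. *)

Record semi_inner (R : realType) (V : lmodType R) := SemiInner {
  form :> V -> V -> R ;
  formC : forall x y, form x y = form y x ;
  formDl : forall x y z, form (x + y) z = form x z + form y z ;
  formZl : forall a x y, form (a *: x) y = a * form x y ;
  form_ge0 : forall x, 0 <= form x x
}.

Section semi_inner_theory.
Context {R : realType} {V : lmodType R} (B : semi_inner V).
Implicit Types (v w : V) (a e : R).

Lemma formDr v w x : B v (w + x) = B v w + B v x.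
Proof. by rewrite formC formDl !(formC _ v). Qed.

Lemma formZr a v w : B v (a *: w) = a * B v w.
Proof. by rewrite formC formZl formC. Qed.

Lemma formNl v w : B (- v) w = - B v w.
Proof. by rewrite -scaleN1r formZl mulN1r. Qed.

Lemma formNr v w : B v (- w) = - B v w.
Proof. by rewrite formC formNl formC. Qed.

Lemma form0l w : B 0 w = 0.
Proof. by rewrite -(scale0r 0) formZl mul0r. Qed.

Definition seminorm v : R := Num.sqrt (B v v).

Lemma seminorm_ge0 v : 0 <= seminorm v.
Proof. exact: sqrtr_ge0. Qed.

Lemma sqr_seminorm v : seminorm v ^+ 2 = B v v.
Proof. by rewrite sqr_sqrtr// form_ge0. Qed.

Lemma seminorm_le v a : 0 <= a -> (seminorm v <= a) = (B v v <= a ^+ 2).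
Proof.
by move=> a0; rewrite -sqr_seminorm ler_pXn2r ?nnegrE ?seminorm_ge0.
Qed.

Lemma form_cauchy_schwarz v w : `|B v w| <= seminorm v * seminorm w.
Proof.
rewrite -ler_sqr ?nnegrE ?mulr_ge0 ?seminorm_ge0// exprMn !sqr_seminorm.
rewrite real_normK ?num_real//.
have [Bw0|Bw0] := eqVneq (B w w) 0; last first.
  (* The projection of [v] off [w], multiplied by [B w w] to avoid a division. *)
  have := form_ge0 B (B w w *: v - B v w *: w).
  rewrite formDl !formDr !formNl !formNr !formZl !formZr (formC B w v).
  rewrite (_ : _ + _ + _ = B w w * (B v v * B w w - B v w ^+ 2)); last by ring.
  by rewrite pmulr_rge0 ?lt0r ?Bw0 ?form_ge0// subr_ge0.
have [->|Bvw0] := eqVneq (B v w) 0; first by rewrite expr0n Bw0 mulr0.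
(* For a null vector [w] the form is affine along [v - a *: w]; this value of [a] makes it [-1]. *)
have := form_ge0 B (v - ((B v v + 1) / (2 * B v w)) *: w).
rewrite formDl !formDr !formNl !formNr !formZl !formZr (formC B w v) Bw0.
rewrite (_ : _ + _ + _ = -1); last by field.
by rewrite oppr_ge0 ler10.
Qed.

Lemma seminormD v w : seminorm (v + w) <= seminorm v + seminorm w.
Proof.
rewrite seminorm_le ?addr_ge0 ?seminorm_ge0// formDl !formDr (formC B w v).
have := le_trans (ler_norm _) (form_cauchy_schwarz v w).
by rewrite sqrrD !sqr_seminorm; lra.
Qed.

Lemma seminormZ a v : seminorm (a *: v) = `|a| * seminorm v.
Proof.
rewrite /seminorm formZl formZr mulrA -expr2 sqrtrM ?sqr_ge0//.
by rewrite sqrtr_sqr.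
Qed.

Lemma seminormN v : seminorm (- v) = seminorm v.
Proof. by rewrite -scaleN1r seminormZ normrN1 mul1r. Qed.

Lemma seminorm0 : seminorm 0 = 0.
Proof. by rewrite /seminorm form0l sqrtr0. Qed.

End semi_inner_theory.

(* The completion consists of the functionals [V -> R] that are limits, for the
   dual norm, of functionals [form B v]; this avoids quotients. *)
Section completion.
Context {R : realType} {V : lmodType R} (B : semi_inner V).
Local Notation sn := (seminorm B).
Implicit Types (v w : V) (h k : V -> R).

Definition approximable h : Prop :=
  forall e, 0 < e -> exists v, forall w, `|h w - B v w| <= e * sn w.

Definition approximable_pred : {pred V -> R} := [pred h | `[< approximable h >]].

Record completion := Completion {
  completion_val :> V -> R ;
  completionP : completion_val \in approximable_pred
}.

HB.instance Definition _ := [isSub for completion_val].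
HB.instance Definition _ := [Choice of completion by <:].

Lemma approximable_subproof : subsemimod_closed approximable_pred.
Proof.
split; first split.
- apply/asboolP => e e0; exists 0 => w.
  by rewrite form0l subr0 normr0 mulr_ge0 ?seminorm_ge0// ltW.
- move=> h k /asboolP ah /asboolP ak; apply/asboolP => e e0.
  have e20 : 0 < e / 2 by rewrite divr_gt0.
  have [v hv] := ah _ e20; have [v' kv'] := ak _ e20.
  exists (v + v') => w; rewrite formDl [_ w]/(h w + k w) opprD addrACA.
  apply: le_trans (ler_normD _ _) _.
  by rewrite (splitr e) mulrDl lerD.
- move=> a h /asboolP ah; apply/asboolP => e e0.
  have a0 : 0 < `|a| + 1 by rewrite ltr_pwDr.
  have [v hv] := ah _ (divr_gt0 e0 a0).
  exists (a *: v) => w; rewrite formZl [_ w]/(a * h w) -mulrBr normrM.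
  apply: le_trans (ler_wpM2l _ (hv w)) _; rewrite // mulrA.
  rewrite ler_wpM2r ?seminorm_ge0// mulrA ler_pdivrMr// mulrC ler_wpM2l//.
    exact: ltW.
  by rewrite lerDl.
Qed.

HB.instance Definition _ := GRing.SubChoice_isSubLmodule.Build R (V -> R)
  approximable_pred completion approximable_subproof.

Implicit Types x y z : completion.

(** The dual norm. Taking the least admissible bound avoids dividing by [sn w], which vanishes on
    null vectors. *)
Definition cnorm x : R :=
  inf [set M | 0 <= M /\ forall w, `|x w| <= M * sn w].

Lemma completionD x y w : (x + y) w = x w + y w.
Proof. by []. Qed.

Lemma completionZ a x w : (a *: x) w = a * x w.
Proof. by []. Qed.

Lemma completionN x w : (- x) w = - x w.
Proof. by []. Qed.

Lemma completion_eq0 x : (forall w, x w = 0) -> x = 0.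
Proof. by move=> x0; apply: val_inj; apply/funext => w; exact: x0. Qed.

Lemma approximable_bounded x : exists M, 0 <= M /\ forall w, `|x w| <= M * sn w.
Proof.
have /asboolP/(_ 1 ltr01)[v xv] := completionP x.
exists (1 + sn v); split; first by rewrite addr_ge0 ?seminorm_ge0.
move=> w; rewrite -(subrK (B v w) (x w)); apply: le_trans (ler_normD _ _) _.
by rewrite mulrDl lerD ?xv ?form_cauchy_schwarz.
Qed.

Lemma cnorm_ge0 x : 0 <= cnorm x.
Proof.
by apply: lb_le_inf => [|M []//]; have [M] := approximable_bounded x; exists M.
Qed.

Lemma cnormP x w : `|x w| <= cnorm x * sn w.
Proof.
have [M0 [M00 xM0]] := approximable_bounded x.
have [w0|w0] := eqVneq (sn w) 0; first by have := xM0 w; rewrite w0 !mulr0.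
have {}w0 : 0 < sn w by rewrite lt0r w0 seminorm_ge0.
rewrite -ler_pdivrMr//; apply: lb_le_inf; first by exists M0.
by move=> M [_ xM]; rewrite ler_pdivrMr.
Qed.

Lemma cnorm_le x M : 0 <= M -> (forall w, `|x w| <= M * sn w) -> cnorm x <= M.
Proof. by move=> M0 xM; apply: ge_inf => //; exists 0 => ? []. Qed.

Lemma ler_cnormD x y : cnorm (x + y) <= cnorm x + cnorm y.
Proof.
apply: cnorm_le => [|w]; first by rewrite addr_ge0 ?cnorm_ge0.
by rewrite mulrDl (le_trans (ler_normD _ _))// lerD ?cnormP.
Qed.

Lemma cnormZ a x : cnorm (a *: x) = `|a| * cnorm x.
Proof.
have le (b : R) y : cnorm (b *: y) <= `|b| * cnorm y.
  apply: cnorm_le => [|w]; first by rewrite mulr_ge0 ?cnorm_ge0.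
  by rewrite completionZ normrM -mulrA ler_wpM2l// cnormP.
apply/eqP; rewrite eq_le le/=; have [->|a0] := eqVneq a 0.
  by rewrite normr0 mul0r cnorm_ge0.
by rewrite -ler_pdivlMl ?normr_gt0// -normfV -{1}(scalerK a0 x) le.
Qed.

Lemma cnorm_eq0 x : cnorm x = 0 -> x = 0.
Proof.
move=> x0; apply: completion_eq0 => w; apply/eqP; rewrite -normr_le0.
by have := cnormP x w; rewrite x0 mul0r.
Qed.

HB.instance Definition _ := @Lmodule_isNormed.Build R completion
  cnorm ler_cnormD cnormZ cnorm_eq0.

Lemma completion_norm_le x M : 0 <= M ->
  (forall w, `|x w| <= M * sn w) -> `|x| <= M.
Proof. exact: cnorm_le. Qed.

Lemma completion_normP x w : `|x w| <= `|x| * sn w.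
Proof. exact: cnormP. Qed.

(** Limits are taken pointwise in [R]. The limit functional stays within [e] of the centre of any
    ball of radius [e] belonging to [F], and that centre is itself close to some [form B v]; hence
    the limit is approximable. *)
Lemma completion_complete (F : set_system completion) :
  ProperFilter F -> cauchy F -> cvg F.
Proof.
move=> FF /cauchyP Fc.
have FcP (e : R) : 0 < e -> exists x : completion, F (ball x e).
  exact: Fc.
have Fw w : cvg ((fun x : completion => x w) @ F).
  apply: R_complete; apply/cauchyP => e e0.
  have w0 : 0 < sn w + 1 by rewrite ltr_wpDl ?seminorm_ge0.
  have [x Fx] := FcP _ (divr_gt0 e0 w0).
  exists (x w); change (F [set y : completion | ball (x w) e (y w)]).
  apply: filterS Fx => y; rewrite -ball_normE/= => xy.
  rewrite /ball/= -[_ - _]/((x - y) w).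
  apply: le_lt_trans (completion_normP _ _) _.
  rewrite -(divfK (lt0r_neq0 w0) e).
  apply: le_lt_trans (_ : _ <= `|x - y| * (sn w + 1)) _.
    by rewrite ler_wpM2l// lerDl.
  by rewrite ltr_pM2r.
pose g w := lim ((fun x : completion => x w) @ F).
have Fg (x : completion) e : F (ball x e) -> forall w, `|x w - g w| <= e * sn w.
  move=> Fx w; apply: (@closed_cvg _ _ F _ (fun y : completion => y w)
    [set r | `|x w - r| <= e * sn w]).
  - apply: (@closed_comp _ _ (fun r => `|x w - r|) [set s | s <= e * sn w]).
      move=> r _; apply: (@cvg_norm _ R^o); apply: (@cvgB _ R^o).
        exact: cvg_cst.
      exact: cvg_id.
    exact: closed_le.
  - apply: filterS Fx => y; rewrite -ball_normE/= => xy.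
    rewrite -[_ - _]/((x - y) w) (le_trans (completion_normP _ _))//.
    by rewrite ler_wpM2r ?seminorm_ge0// ltW.
  - exact: Fw.
have gP : g \in approximable_pred.
  apply/asboolP => e e0; have e20 : 0 < e / 2 by rewrite divr_gt0.
  have [x Fx] := FcP _ e20.
  have /asboolP/(_ _ e20)[v xv] := completionP x.
  exists v => w; rewrite -(subrKA (x w)); apply: le_trans (ler_normD _ _) _.
  by rewrite (splitr e) mulrDl lerD// distrC Fg.
apply/cvg_ex; exists (Completion gP); apply/cvg_ballP => e e0.
have e20 : 0 < e / 2 by rewrite divr_gt0.
have [x Fx] := FcP _ e20; apply: filterS (Fx) => y.
rewrite -!ball_normE/= => xy.
have gx : `|Completion gP - x| <= e / 2.
  apply: completion_norm_le => [|w]; first exact: ltW.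
  by rewrite completionD completionN distrC; exact: Fg.
by rewrite -(subrKA x) (splitr e) (le_lt_trans (ler_normD _ _))// ler_ltD.
Qed.

HB.instance Definition _ := Uniform_isComplete.Build completion
  completion_complete.

Lemma cemb_subproof v : B v \in approximable_pred.
Proof.
apply/asboolP => e e0; exists v => w.
by rewrite subrr normr0 mulr_ge0 ?seminorm_ge0// ltW.
Qed.

Definition cemb v : completion := Completion (cemb_subproof v).

Lemma cemb_is_linear : linear cemb.
Proof.
by move=> a v v'; apply: val_inj; apply/funext => w /=; rewrite formDl formZl.
Qed.

HB.instance Definition _ :=
  GRing.isLinear.Build R V completion *:%R cemb cemb_is_linear.

Lemma normr_cemb v : `|cemb v| = sn v.
Proof.
apply/eqP; rewrite eq_le completion_norm_le ?seminorm_ge0//=; last first.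
  exact: form_cauchy_schwarz.
have [->//|v0] := eqVneq (sn v) 0.
have {}v0 : 0 < sn v by rewrite lt0r v0 seminorm_ge0.
by rewrite -(ler_pM2r v0) -expr2 sqr_seminorm (le_trans (ler_norm _))//
  (completion_normP (cemb v)).
Qed.

Lemma cemb_dense x e : 0 < e -> exists v, `|x - cemb v| <= e.
Proof.
move=> e0; have /asboolP/(_ e e0)[v xv] := completionP x.
by exists v; apply: completion_norm_le; rewrite ?ltW.
Qed.

Lemma cemb_cvg x : exists u : nat -> V, cemb (u n) @[n --> \oo] --> x.
Proof.
have /choice[u xu] n : exists v, `|x - cemb v| <= n.+1%:R^-1.
  by apply: cemb_dense; rewrite invr_gt0.
exists u; apply/cvgrPdist_le => e e0; near=> n.
apply: le_trans (xu n) _; rewrite ltW//.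
by near: n; exact: near_infty_natSinv_lt (PosNum e0).
Unshelve. all: by end_near. Qed.

(** Polarization makes continuity in the norm immediate; bilinearity then follows by density from
    that of [B]. *)
Definition cinner x y : R := (`|x + y| ^+ 2 - `|x - y| ^+ 2) / 4.

Lemma cinner_cemb v w : cinner (cemb v) (cemb w) = B v w.
Proof.
rewrite /cinner -!raddfD -raddfB !normr_cemb !sqr_seminorm.
by rewrite !formDl !formDr !formNl !formNr (formC B w v); field.
Qed.

Lemma cvg_cinner (u v : nat -> completion) x y :
  u n @[n --> \oo] --> x -> v n @[n --> \oo] --> y ->
  cinner (u n) (v n) @[n --> \oo] --> cinner x y.
Proof.
have sq (f : nat -> completion) a : f n @[n --> \oo] --> a ->
    `|f n| ^+ 2 @[n --> \oo] --> `|a| ^+ 2.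
  by move=> fa; rewrite expr2; apply: cvgM; exact: cvg_norm.
move=> ux vy; apply: cvgMr_tmp; apply: cvgB; apply: sq; first exact: cvgD.
exact: cvgB.
Qed.

Lemma cinnerC x y : cinner x y = cinner y x.
Proof. by rewrite /cinner (addrC x) (distrC x). Qed.

Lemma cinnerDl x y z : cinner (x + y) z = cinner x z + cinner y z.
Proof.
have [u ux] := cemb_cvg x; have [v vy] := cemb_cvg y; have [w wz] := cemb_cvg z.
apply: (@cvg_unique _ (@Rhausdorff R)
  (cinner (cemb (u n) + cemb (v n)) (cemb (w n)) @[n --> \oo])).
  by apply: cvg_cinner => //; apply: cvgD.
rewrite (_ : (fun n => _) = fun n => cinner (cemb (u n)) (cemb (w n)) +
    cinner (cemb (v n)) (cemb (w n))); last first.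
  by apply/funext => n; rewrite -raddfD !cinner_cemb formDl.
by apply: cvgD; apply: cvg_cinner.
Qed.

Lemma cinnerZl a x y : cinner (a *: x) y = a * cinner x y.
Proof.
have [u ux] := cemb_cvg x; have [v vy] := cemb_cvg y.
apply: (@cvg_unique _ (@Rhausdorff R)
  (cinner (a *: cemb (u n)) (cemb (v n)) @[n --> \oo])).
  by apply: cvg_cinner => //; apply: cvgZl_tmp.
rewrite (_ : (fun n => _) = fun n => a * cinner (cemb (u n)) (cemb (v n))); last first.
  by apply/funext => n; rewrite -linearZ !cinner_cemb formZl.
by apply: cvgMl_tmp; apply: cvg_cinner.
Qed.

Lemma norm_cinner x : `|x| ^+ 2 = cinner x x.
Proof.
rewrite /cinner subrr normr0 -mulr2n -scaler_nat normrZ ger0_norm//.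
by rewrite expr0n subr0 exprMn; field.
Qed.

HB.instance Definition _ := isHilbert.Build R completion
  cinnerC cinnerDl cinnerZl norm_cinner.

End completion.

(** * Extension of bounded operators to the completion *)

Section extension.
Context {R : realType} {V : lmodType R} (B : semi_inner V).
Local Notation sn := (seminorm B).
Local Notation H := (completion B : hilbertType R).

(** A single inequality contains both agreement with [T] (take [x = cemb B v]) and the norm bound
    (take [v = 0]). *)
Definition extends (T : V -> V) (T' : H -> H) (L : R) : Prop :=
  forall x v, `|T' x - cemb B (T v)| <= L * `|x - cemb B v|.

(** Density of the image of [V] determines such a point. Identities between extended maps are proved
    this way, by checking them on [V] only. *)
Lemma completion_eq x y (L : R) (f : V -> H) : 0 <= L ->
  (forall v, `|y - f v| <= L * `|x - cemb B v|) ->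
  forall y', (forall v, `|y' - f v| <= L * `|x - cemb B v|) -> y = y'.
Proof.
move=> L0 yf y' y'f; apply/eqP; rewrite -subr_eq0 -normr_le0.
apply/ler_addgt0Pl => e e0; rewrite addr0.
(* [L + 1] instead of [L], which may be zero. *)
have L10 : 0 < 2 * (L + 1) by rewrite mulr_gt0// ltr_wpDl.
have [v xv] := cemb_dense x (divr_gt0 e0 L10).
rewrite -(subrKA (f v)) (le_trans (ler_normD _ _))//.
rewrite (distrC (f v)) (le_trans (lerD (yf v) (y'f v)))//.
have := ler_wpM2l L0 xv.
have : (L + 1) * (e / (2 * (L + 1))) = e / 2 by field; rewrite lt0r_neq0// ltr_wpDl.
have : 0 <= e / (2 * (L + 1)) by rewrite ltW// divr_gt0.
by lra.
Qed.

Lemma extension (T : {linear V -> V}) (L : R) : 0 <= L ->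
  (forall v, sn (T v) <= L * sn v) -> exists T' : {linear H -> H}, extends T T' L.
Proof.
move=> L0 TL.
have TL' v w : `|cemb B (T v) - cemb B (T w)| <= L * `|cemb B v - cemb B w|.
  by have := TL (v - w); rewrite [T _]raddfB -!normr_cemb !raddfB.
(* The value at each [x] is chosen separately; the inequality characterizes it, so linearity can be
   recovered afterwards. *)
have /choice[T' T'P] (x : H) :
    exists y : H, forall v, `|y - cemb B (T v)| <= L * `|x - cemb B v|.
  have [u ux] := cemb_cvg x.
  have cy : cvg (cemb B (T (u n)) @[n --> \oo]).
    apply/cauchy_cvgP/cauchyP => e e0.
    have L10 : 0 < L + 1 by rewrite ltr_wpDl.
    have [N _ NP] := (cvgrPdist_le _ _).1 ux _ (divr_gt0 e0 (mulr_gt0 (ltr0Sn R 3) L10)).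
    exists (cemb B (T (u N))); exists N => // n /= Nn.
    rewrite -ball_normE/= (le_lt_trans (TL' _ _))// -(subrKA x).
    have xN := NP N (leqnn N); have xn := NP _ Nn; rewrite distrC in xN.
    apply: le_lt_trans (ler_wpM2l L0 (le_trans (ler_normD _ _) (lerD xN xn))) _.
    have E : (L + 1) * (e / (4 * (L + 1))) = e / 4.
      by field; rewrite lt0r_neq0.
    have : 0 <= e / (4 * (L + 1)) by rewrite ltW// divr_gt0// mulr_gt0.
    by lra.
  exists (lim (cemb B (T (u n)) @[n --> \oo])) => v.
  pose l := lim (cemb B (T (u n)) @[n --> \oo]).
  have lim1 : `|cemb B (T (u n)) - cemb B (T v)| @[n --> \oo] --> `|l - cemb B (T v)|.
    by apply: cvg_norm; apply: cvgB; [exact: cy|exact: cvg_cst].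
  have lim2 : `|cemb B (u n) - cemb B v| @[n --> \oo] --> `|x - cemb B v|.
    by apply: cvg_norm; apply: cvgB; [exact: ux|exact: cvg_cst].
  apply: (ler_cvg_to lim1 (cvgMl_tmp lim2)).
  by near=> n; exact: TL'.
have lin : linear T'.
  move=> a x y.
  have [u ux] := cemb_cvg x; have [v vy] := cemb_cvg y.
  have T'cvg (z : H) (w : nat -> V) : cemb B (w n) @[n --> \oo] --> z ->
      cemb B (T (w n)) @[n --> \oo] --> T' z.
    move=> wz; apply/cvgrPdist_le => e e0.
    have L10 : 0 < L + 1 by rewrite ltr_wpDl.
    apply: filterS ((cvgrPdist_le _ _).1 wz _ (divr_gt0 e0 L10)) => n zn.
    apply: le_trans (T'P z (w n)) _.
    apply: (@le_trans _ _ ((L + 1) * (e / (L + 1)))); last first.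
      by rewrite mulrC divfK// lt0r_neq0.
    by apply: ler_pM => //; rewrite lerDl.
  have xy : cemb B (a *: u n + v n) @[n --> \oo] --> a *: x + y.
    rewrite (_ : (fun n => _) = fun n => a *: cemb B (u n) + cemb B (v n)).
      by apply: cvgD => //; exact: cvgZl_tmp.
    by apply/funext => n; rewrite linearP.
  apply: (@cvg_unique _ (@norm_hausdorff R H)
    (cemb B (T (a *: u n + v n)) @[n --> \oo])); first exact: T'cvg.
  rewrite (_ : (fun n => _) = fun n => a *: cemb B (T (u n)) + cemb B (T (v n))); last first.
    by apply/funext => n; rewrite !linearP.
  by apply: cvgD; [apply: cvgZl_tmp; apply: T'cvg|apply: T'cvg].
pose T'l : {linear H -> H} :=
  HB.pack T' (GRing.isLinear.Build R H H *:%R T' lin).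
by exists T'l.
Unshelve. all: by end_near. Qed.

End extension.

(** * Affine actions on completions *)

Section opnorm.
Context {R : realType} {V W : normedModType R}.
Implicit Types (T : {linear V -> W}) (L : R).

Lemma opnorm_le T L : 0 <= L -> (forall h, `|T h| <= L * `|h|) ->
  (opnorm T <= L%:E)%E.
Proof.
move=> L0 TL; apply: ge_ereal_sup => _ [h h1 <-].
by rewrite lee_fin (le_trans (TL h))// ler_piMr.
Qed.

Lemma opnormP T L : (opnorm T <= L%:E)%E -> forall h, `|T h| <= L * `|h|.
Proof.
move=> TL h; have [->|h0] := eqVneq h 0; first by rewrite raddf0 !normr0 mulr0.
have {}h0 : 0 < `|h| by rewrite normr_gt0.
rewrite -ler_pdivrMr// -lee_fin; apply: le_trans TL; apply: ereal_sup_ubound.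
exists (`|h|^-1 *: h) => /=; last first.
  by rewrite linearZ normrZ ger0_norm ?invr_ge0// mulrC.
by rewrite normrZ ger0_norm ?invr_ge0// mulVf ?gt_eqF.
Qed.

Lemma affine_iso_boundedP L (psi : affine_iso V W) : affine_iso_bounded L psi <->
  (affine_norm psi <= L%:E)%E /\ (affine_norm (affine_inv psi) <= L%:E)%E.
Proof.
by rewrite /affine_iso_bounded ge_max; split=> [/andP|[-> ->]].
Qed.

End opnorm.

Section affine_extension.
Context {R : realType} {V : lmodType R} (B : semi_inner V).
Local Notation sn := (seminorm B).
Local Notation H := (completion B : hilbertType R).

Lemma cemb_eq v w : sn (v - w) = 0 -> cemb B v = cemb B w.
Proof.
by rewrite -normr_cemb raddfB => /normr0_eq0/subr0_eq.
Qed.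

Lemma cembD v w : cemb B (v + w) = cemb B v + cemb B w.
Proof. exact: raddfD. Qed.

(* The relations between [T] and [b] are only required modulo null vectors. *)
Lemma affine_action_extension (G : groupType) (T : G -> {linear V -> V})
    (b : G -> V) (L : R) : 0 <= L ->
  (forall g v, sn (T g v) <= L * sn v) ->
  (forall v, sn (T 1%g v - v) = 0) ->
  (forall g h v, sn (T (g * h)%g v - T g (T h v)) = 0) ->
  (forall g h, sn (b (g * h)%g - (T g (b h) + b g)) = 0) ->
  exists alpha : G -> affine_iso H H,
  [/\ forall g v, alpha g (cemb B v) = cemb B (T g v + b g),
      forall g h x, alpha (g * h)%g x = alpha g (alpha h x),
      forall g, affine_iso_bounded L (alpha g) &
      forall g x, affine_inv (alpha g) x = alpha g^-1%g x].
Proof.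
move=> L0 TL T1 TM bM.
have /choice[T' T'P] g := extension L0 (TL g).
pose A g := Affine (T' g) (cemb B (b g)).
have AP g x v : `|A g x - cemb B (T g v + b g)| <= L * `|x - cemb B v|.
  by rewrite /affine_fun /= raddfD opprD addrACA subrr addr0; exact: T'P.
have Ac g v : A g (cemb B v) = cemb B (T g v + b g).
  have := AP g (cemb B v) v; rewrite subrr normr0 mulr0 normr_le0 subr_eq0.
  by move/eqP.
have AM g h x : A (g * h)%g x = A g (A h x).
  have ghE v : cemb B (T (g * h)%g v + b (g * h)%g) =
      cemb B (T g (T h v + b h) + b g).
    rewrite cembD (cemb_eq (TM g h v)) (cemb_eq (bM g h)) -cembD.
    by rewrite [T g (_ + _)]raddfD addrA.
  apply: (@completion_eq _ _ _ x _ (L + L * L)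
    (fun v => cemb B (T (g * h)%g v + b (g * h)%g))) => [|v|v].
  - by rewrite addr_ge0// mulr_ge0.
  - by rewrite (le_trans (AP _ _ v))// mulrDl lerDl !mulr_ge0.
  - rewrite ghE (le_trans (AP _ _ (T h v + b h)))// mulrDl ler_wpDl ?mulr_ge0//.
    by rewrite -mulrA ler_wpM2l.
have A1 x : A 1%g x = x.
  have b10 : cemb B (b 1%g) = 0.
    (* The cocycle relation at the pair of identities makes [b 1] a null vector. *)
    have := cemb_eq (bM 1%g 1%g); rewrite mulg1 cembD (cemb_eq (T1 _)).
    by move/eqP; rewrite -subr_eq0 opprD addrA subrr sub0r oppr_eq0 => /eqP.
  apply: (@completion_eq _ _ _ x _ (L + 1)
    (fun v => cemb B (T 1%g v + b 1%g))) => [|v|v].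
  - by rewrite addr_ge0.
  - by rewrite (le_trans (AP _ _ v))// ler_wpM2r// lerDl.
  - by rewrite cembD b10 addr0 (cemb_eq (T1 _)) mulrDl mul1r lerDr mulr_ge0.
have AK g : cancel (A g) (A g^-1%g) by move=> x; rewrite -AM mulVg A1.
have AK' g : cancel (A g^-1%g) (A g) by move=> x; rewrite -AM mulgV A1.
have AL g : (affine_norm (A g) <= L%:E)%E.
  apply: opnorm_le => // h /=; have := AP g h 0.
  rewrite [cemb B 0]raddf0 subr0 [T g 0]raddf0 add0r /affine_fun /=.
  by rewrite addrK.
exists (fun g => AffineIso (AK g) (AK' g)); split=> //=.
by move=> g; apply/affine_iso_boundedP; split; exact: AL.
Qed.

End affine_extension.

(** * Separability of completions *)

Section separability.
Context {R : realType} {V : lmodType R} (B : semi_inner V).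
Local Notation sn := (seminorm B).
Context {J : countType} (a : J -> V).

Definition lincomb (l : seq (R * J)) : V := \sum_(p <- l) p.1 *: a p.2.

Definition in_closed_span v : Prop :=
  forall e, 0 < e -> exists l, sn (v - lincomb l) <= e.

Lemma in_closed_span_gen j : in_closed_span (a j).
Proof.
move=> e e0; exists [:: (1, j)].
by rewrite /lincomb big_seq1 scale1r subrr seminorm0 ltW.
Qed.

Lemma in_closed_spanD v w :
  in_closed_span v -> in_closed_span w -> in_closed_span (v + w).
Proof.
move=> hv hw e e0; have e20 : 0 < e / 2 by rewrite divr_gt0.
have [l vl] := hv _ e20; have [k wk] := hw _ e20; exists (l ++ k).
rewrite /lincomb big_cat opprD addrACA (le_trans (seminormD _ _ _))//.
by rewrite (splitr e) lerD.
Qed.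

Lemma in_closed_spanZ c v : in_closed_span v -> in_closed_span (c *: v).
Proof.
move=> hv e e0; have c0 : 0 < `|c| + 1 by rewrite ltr_wpDl.
have [l vl] := hv _ (divr_gt0 e0 c0); exists [seq (c * p.1, p.2) | p <- l].
rewrite /lincomb big_map /=.
under eq_bigr do rewrite -scalerA.
rewrite -scaler_sumr -scalerBr seminormZ.
apply: (@le_trans _ _ ((`|c| + 1) * (e / (`|c| + 1)))); last first.
  by rewrite mulrC divfK// lt0r_neq0.
by apply: ler_pM => //; rewrite ?seminorm_ge0// lerDl.
Qed.

Lemma in_closed_span_closed v :
  (forall e, 0 < e -> exists2 w, in_closed_span w & sn (v - w) <= e) ->
  in_closed_span v.
Proof.
move=> hv e e0; have e20 : 0 < e / 2 by rewrite divr_gt0.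
have [w hw vw] := hv _ e20; have [l wl] := hw _ e20; exists l.
rewrite -(subrKA w) (le_trans (seminormD _ _ _))//.
by rewrite (splitr e) lerD.
Qed.

(** Rational combinations of the [a j] are countable and suffice: an error on the coefficient of
    [a j] is multiplied by [sn (a j)], whence the tolerance divided by [sn (a j) + 1]. *)
Lemma separable_completion :
  (forall v, in_closed_span v) -> separable (completion B).
Proof.
move=> hspan.
pose q (l : seq (rat * J)) := lincomb [seq (ratr p.1, p.2) | p <- l].
have ql l e : 0 < e -> exists l', sn (lincomb l - q l') <= e.
  elim: l e => [|[c j] l IH] e e0.
    by exists [::]; rewrite /q /lincomb !big_nil subrr seminorm0 ltW.
  have e20 : 0 < e / 2 by rewrite divr_gt0.
  have [l' ll'] := IH _ e20.
  have a0 : 0 < sn (a j) + 1 by rewrite ltr_wpDl// seminorm_ge0.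
  have ec : c < c + e / 2 / (sn (a j) + 1) by rewrite ltrDl divr_gt0.
  have [x /itvP cx] := rat_in_itvoo ec.
  exists ((x, j) :: l').
  rewrite /q /lincomb /= !big_cons /= opprD addrACA (le_trans (seminormD _ _ _))//.
  rewrite (splitr e) lerD// -scalerBl seminormZ.
  apply: (@le_trans _ _ ((e / 2 / (sn (a j) + 1)) * (sn (a j) + 1))); last first.
    by rewrite divfK// lt0r_neq0.
  apply: ler_pM; rewrite ?seminorm_ge0// ?lerDl// distrC ger0_norm.
    by rewrite lerBlDl cx.
  by rewrite subr_ge0 cx.
exists (range (fun l => cemb B (q l))); split.
  exact: sub_countable (card_image_le _ _) (countableP _).
move=> O [x Ox] oO; have /nbhs_ballP[e /= e0 xeO] := open_nbhs_nbhs (conj oO Ox).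
have e30 : 0 < e / 4 by rewrite divr_gt0.
have [v xv] := cemb_dense x e30.
have [l vl] := hspan v _ e30; have [l' ll'] := ql l _ e30.
exists (cemb B (q l')); split; last by exists l'.
apply: xeO; rewrite -ball_normE /=.
rewrite -(subrKA (cemb B v)) (le_lt_trans (ler_normD _ _))//.
rewrite -raddfB normr_cemb -(subrKA (lincomb l)).
have := seminormD B (v - lincomb l) (lincomb l - q l').
by lra.
Qed.

End separability.

(** * Word balls and warped distances *)

Section word_balls.
Context {G : groupType} (S : seq G).

(** Sequences give decidable membership, finiteness and sums over balls at once. Each ball is a
    prefix of the next one. *)
Fixpoint wball (k : nat) : seq G :=
  if k is k'.+1 then wball k' ++ [seq (s * g)%g | s <- S, g <- wball k']
  else [:: 1%g].

Arguments wball : simpl never.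

Lemma in_wballS k g : (g \in wball k.+1) =
  (g \in wball k) || (g \in [seq (s * h)%g | s <- S, h <- wball k]).
Proof. exact: mem_cat. Qed.

Lemma wball1 k : 1%g \in wball k.
Proof. by elim: k => [|k IH]; rewrite ?inE// in_wballS IH. Qed.

Lemma wballS k s g : s \in S -> g \in wball k -> (s * g)%g \in wball k.+1.
Proof.
by move=> sS gk; rewrite /= mem_cat; apply/orP; right; exact: allpairs_f.
Qed.

Lemma sub_wball k l : (k <= l)%N -> {subset wball k <= wball l}.
Proof.
move=> /subnK <-; elim: (l - k)%N => // m IH g /IH gm.
by rewrite addSn in_wballS gm.
Qed.

Lemma wballM k l g h :
  g \in wball k -> h \in wball l -> (g * h)%g \in wball (k + l).
Proof.
move=> + hl; elim: k g => [|k IH] g; first by rewrite inE => /eqP ->; rewrite mul1g.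
rewrite in_wballS => /orP[/IH|/allpairsP[[s g'] /= [sS /IH g'k ->]]].
  by move=> gh; apply: sub_wball gh; rewrite addSn.
by rewrite -mulgA; exact: wballS.
Qed.

Hypothesis hS : symmetric_generating S.

Lemma wballV k g : g \in wball k -> g^-1%g \in wball k.
Proof.
elim: k g => [|k IH] g; first by rewrite !inE => /eqP ->; rewrite invg1.
rewrite in_wballS => /orP[/IH gk|/allpairsP[[s g'] /= [sS /IH g'k ->]]].
  by rewrite in_wballS gk.
rewrite invgM -addn1; apply: wballM => //.
by rewrite -(mulg1 s^-1%g); apply: wballS; rewrite ?hS.1// inE.
Qed.

Lemma wball_exists g : exists k, g \in wball k.
Proof.
have [w [wS ->]] := hS.2 g; elim: w wS => [|s w IH] wS.
  by exists 0%N; rewrite big_nil inE.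
have [|k wk] := IH; first by move=> x xw; apply: wS; rewrite inE xw orbT.
exists k.+1; rewrite big_cons; apply: wballS => //.
by apply: wS; rewrite inE eqxx.
Qed.

(** An index encodes a radius and a position in the ball of that radius. The enumeration may repeat
    elements. *)
Lemma countable_group : exists e : nat -> G, forall g, exists i, e i = g.
Proof.
have [idx idxP] := choice wball_exists.
exists (fun i => if unpickle i is Some (k, j) then nth 1%g (wball k) j else 1%g).
move=> g; exists (pickle (idx g, index g (wball (idx g)))).
by rewrite pickleK nth_index.
Qed.

Lemma finite_group_set (P : set G) (k : nat) :
  (forall g, P g -> g \in wball k) -> finite_set P.
Proof. by move=> Pk; apply: sub_finite_set (finite_seq (wball k)). Qed.

Lemma finite_group_setP (P : set G) : finite_set P ->
  exists k, forall g, P g -> g \in wball k.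
Proof.
move=> /finite_fsetP[X ->].
elim/finmap.finSet_rect: X => X IH; have [idx idxP] := choice wball_exists.
exists (\max_(g <- finmap.enum_fset X) idx g)%N => g gX.
apply: (sub_wball _ (idxP g)); rewrite (big_rem g)//= leq_max leqnn//.
Qed.

End word_balls.

Arguments wball {G} S k : simpl never.

(** * The warped metric as an infimum over chains *)

Section warped.
Context {R : realType} {X : Type} {G : groupType}.
Variables (d : X -> X -> R) (act : G -> X -> X) (S : seq G).
Hypotheses (dm : is_metric d) (hS : symmetric_generating S)
  (hact : is_action act).
Local Notation dG := (warped_dist d act S).

(* A pseudo-metric [D] suffices: its maximum with [min 1 d] is a metric. *)
Lemma le_warped_dist (D : X -> X -> R) :
  (forall x, D x x = 0) -> (forall x y, D x y = D y x) ->
  (forall x y z, D x z <= D x y + D y z) -> (forall x y, D x y <= d x y) ->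
  (forall x s, s \in S -> D x (act s x) <= 1) -> forall x y, D x y <= dG x y.
Proof.
move=> Dxx DC DT Dd D1 x y.
have D0 u v : 0 <= D u v by have := DT u v u; rewrite Dxx (DC v); lra.
have [[m0 mE mC mT] md m1] := warped_candidate_min1 act S dm.
have [_ dGmax] := warped_distP act S dm.
apply: (@le_trans _ _ (Num.max (D x y) (Num.min 1 (d x y)))).
  by rewrite le_max lexx.
move: x y; apply: dGmax; split; first split.
- by move=> x y; rewrite le_max D0.
- move=> x y; rewrite -mE; split=> [|xy].
    have := D0 x y; have := m0 x y.
    by rewrite maxEle; case: ifP => // /negbT; rewrite -ltNge => *; lra.
  by rewrite xy; have /mE -> := xy; rewrite Dxx maxxx.
- by move=> x y; rewrite DC mC.
- move=> x y z; rewrite ge_max; apply/andP; split.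
    by rewrite (le_trans (DT x y z))// lerD// le_max lexx.
  by rewrite (le_trans (mT x y z))// lerD// le_max lexx orbT.
- by move=> x y; rewrite ge_max Dd md.
- by move=> x s sS; rewrite ge_max D1// m1.
Qed.

(** Paths alternating jumps of [d] with generator moves; only the total cost is recorded, so that
    the infimum runs over a set of reals. *)
Inductive chain (x : X) : X -> R -> Prop :=
| chain_nil : chain x x 0
| chain_jump y z c : chain x y c -> chain x z (c + d y z)
| chain_move y s c : s \in S -> chain x y c -> chain x (act s y) (c + 1).

Lemma chain_ge0 x y c : chain x y c -> 0 <= c.
Proof.
have [d0 _ _ _] := dm.
by elim=> // *; rewrite addr_ge0.
Qed.

Lemma chain_cat x y z c c' : chain x y c -> chain y z c' -> chain x z (c + c').
Proof.
move=> xy; elim=> [|? ? ? _ ?|? ? ? ? _ ?]; first by rewrite addr0.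
  by rewrite addrA; exact: chain_jump.
by rewrite addrA; exact: chain_move.
Qed.

Lemma chain_dist x y : chain x y (d x y).
Proof. by rewrite -[d x y]add0r; exact/chain_jump/chain_nil. Qed.

Lemma chain_act x s : s \in S -> chain x (act s x) 1.
Proof. by move=> sS; have := chain_move sS (chain_nil x); rewrite add0r. Qed.

Lemma chain_sym x y c : chain x y c -> chain y x c.
Proof.
have [_ _ dC _] := dm; elim=> [|u v e _ IH|u s e sS _ IH]; first exact: chain_nil.
  by rewrite addrC dC; apply: chain_cat IH; exact: chain_dist.
rewrite addrC; apply: chain_cat IH.
have := chain_act (act s u) (hS.1 _ sS).
by rewrite -hact.2 mulVg hact.1.
Qed.

Let chain_costs x y := [set c | chain x y c].

Let chain_inf x y := inf (chain_costs x y).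

Let has_inf_costs x y : has_inf (chain_costs x y).
Proof.
split; first by exists (d x y); exact: chain_dist.
by exists 0 => c /chain_ge0.
Qed.

Let chain_inf_le x y c : chain x y c -> chain_inf x y <= c.
Proof. by move=> xy; apply: ge_inf => //; case: (has_inf_costs x y). Qed.

Let chain_inf_ge0 x y : 0 <= chain_inf x y.
Proof. by apply: lb_le_inf => [|c /chain_ge0//]; case: (has_inf_costs x y). Qed.

Let chain_inf_triangle x y z : chain_inf x z <= chain_inf x y + chain_inf y z.
Proof.
apply/ler_addgt0Pl => e e0; have e20 : 0 < e / 2 by rewrite divr_gt0.
have [c xc cl] := inf_adherent e20 (has_inf_costs x y).
have [c' yc' cl'] := inf_adherent e20 (has_inf_costs y z).
have := chain_inf_le (chain_cat xc yc'); rewrite (splitr e).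
by rewrite -/(chain_inf x y) -/(chain_inf y z) in cl cl' *; lra.
Qed.

(** The infimum of chain costs is a pseudo-metric satisfying the two constraints of the warped
    metric, hence lies below [dG] by maximality. *)
Lemma warped_dist_chain x y r : dG x y < r -> exists2 c, chain x y c & c < r.
Proof.
move=> xyr; suff /le_lt_trans/(_ xyr)/inf_lt : chain_inf x y <= dG x y.
  by apply; case: (has_inf_costs x y).
move: x y {r xyr}; apply: le_warped_dist => x.
- by apply/eqP; rewrite eq_le chain_inf_ge0 andbT chain_inf_le//; exact: chain_nil.
- move=> y; congr inf; apply/seteqP; split=> c; exact: chain_sym.
- by move=> y z; exact: chain_inf_triangle.
- by move=> y; apply: chain_inf_le; exact: chain_dist.
- by move=> s sS; apply: chain_inf_le; exact: chain_act.
Qed.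

Lemma warped_dist_metric : is_metric dG.
Proof. by have [[]] := warped_distP act S dm. Qed.

Lemma warped_dist_le x y : dG x y <= d x y.
Proof. by have [[_ ? _] _] := warped_distP act S dm. Qed.

Lemma warped_dist_wball k g x : g \in wball S k -> dG x (act g x) <= k%:R.
Proof.
have [[[_ dGE _ dGT] _ dG1] _] := warped_distP act S dm.
elim: k g => [|k IH] g.
  by rewrite inE => /eqP ->; rewrite hact.1 (dGE x x).2.
rewrite in_wballS => /orP[/IH|/allpairsP[[s g'] /= [sS /IH g'k ->]]].
  by move=> /le_trans -> //; rewrite ler_nat.
rewrite hact.2 (le_trans (dGT _ (act g' x) _))// -addn1 natrD lerD//.
exact: dG1.
Qed.

End warped.

(** * Paths in the warped cone *)

Section cone.
Context {R : realType} {Y : metricType R} {G : groupType}.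
Variables (act : G -> Y -> Y) (S : seq G).
Hypotheses (hS : symmetric_generating S) (hact : is_action act)
  (hdiam : (diam (@mdist R Y) setT <= 2%:E)%E).
Local Notation dG := (warped_cone_dist act S).
Local Notation dist := (@mdist R Y).

Let dm := cone_dist_metric hdiam.

Lemma cone_act_action : is_action (cone_act act).
Proof.
by split=> [[t y]|g h [t y]]; rewrite /cone_act /= ?hact.1 ?hact.2.
Qed.

Lemma warped_cone_metric : is_metric dG.
Proof. exact: warped_dist_metric. Qed.

(** The difference of levels is a pseudo-metric below [cone_dist], and the action does not change
    levels; maximality of the warped metric applies. *)
Lemma warped_cone_dist_ge (p q : @cone R Y) : `|sval p.1 - sval q.1| <= dG p q.
Proof.
move: p q; apply: le_warped_dist => //.
- by move=> p; rewrite subrr normr0.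
- by move=> p q; rewrite distrC.
- by move=> p q r; exact: ler_distD.
- move=> [[t t1] x] [[u u1] y]; rewrite /cone_dist /= lerDl mulr_ge0 ?mdist_ge0//.
  by rewrite le_min !(le_trans ler01).
- by move=> p s _; rewrite subrr normr0.
Qed.

Lemma warped_cone_dist_le (p q : @cone R Y) g k : g \in wball S k ->
  dG p q <= k%:R + cone_dist (cone_act act g p) q.
Proof.
move=> gk; have [_ _ _ dGT] := warped_cone_metric.
apply: le_trans (dGT p (cone_act act g p) q) _; rewrite lerD//.
  exact: (warped_dist_wball dm cone_act_action).
exact: warped_dist_le.
Qed.

(* [reach k a y z]: one gets from [y] to [z] by [k] generator moves, separated
   by jumps of total length at most [a]. *)
Fixpoint reach (k : nat) (a : R) (y z : Y) : Prop :=
  if k is k'.+1 then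
    exists u s b, [/\ s \in S, reach k' b y u & b + dist (act s u) z <= a]
  else dist y z <= a.

Lemma reach_jump k a y u v : reach k a y u -> reach k (a + dist u v) y v.
Proof.
case: k => [|k] /=.
  by move=> yu; rewrite (le_trans (metric_triangle _ u _))// lerD2r.
move=> [w [s [b [sS yw ba]]]]; exists w, s, b; split=> //.
by have := metric_triangle (act s w) u v; lra.
Qed.

Lemma reach_sub k a b y z : a <= b -> reach k a y z -> reach k b y z.
Proof.
case: k => [|k] /= ab; first by move/le_trans; apply.
by move=> [w [s [c [sS yw ca]]]]; exists w, s, c; split=> //; exact: le_trans ca ab.
Qed.

Lemma reach_ge0 k a y z : reach k a y z -> 0 <= a.
Proof.
elim: k a z => [|k IH] a z /=; first exact/le_trans/mdist_ge0.
by move=> [w [s [c [sS /IH c0 ca]]]]; have := mdist_ge0 (act s w) z; lra.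
Qed.

(** A path of cost [c] descends by at most [c], so it stays above level [m], where a jump of length
    [a] in [Y] costs at least [m * a]. The bound on the change of level is the invariant that makes
    the induction work. *)
Lemma cone_chain_reach (p q : @cone R Y) c m :
  chain (@cone_dist R Y) (cone_act act) S p q c -> 0 <= m -> m <= sval p.1 - c ->
  exists k a, [/\ reach k a p.2 q.2, k%:R + m * a <= c & `|sval p.1 - sval q.1| <= c].
Proof.
move=> pq m0; elim: pq => [|u v e pu IH|u s e sS pu IH] me.
- by exists 0%N, 0; rewrite /= mdistxx mulr0 addr0 subrr normr0.
- have [d0 _ _ _] := dm; have uv0 := d0 u v.
  have [|k [a [pua ka tu]]] := IH; first by lra.
  exists k, (a + dist u.2 v.2).
  (* Both ends of the jump lie above [m]: the cost so far bounds the descent to [u], and the jump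
     itself bounds the further descent to [v]. *)
  have uvE : `|sval u.1 - sval v.1| + m * dist u.2 v.2 <= cone_dist u v.
    rewrite /cone_dist lerD2l ler_wpM2r ?mdist_ge0// le_min.
    have := ler_norm (sval p.1 - sval u.1).
    have : `|sval u.1 - sval v.1| <= cone_dist u v.
      rewrite /cone_dist lerDl mulr_ge0 ?mdist_ge0// le_min.
      by case: u.1 v.1 => [t t1] [t' t'1] /=; rewrite !(le_trans ler01).
    have := ler_norm (sval u.1 - sval v.1).
    by move=> *; apply/andP; split; lra.
  have h1 : 0 <= m * dist u.2 v.2 by rewrite mulr_ge0 ?mdist_ge0.
  have h2 := normr_ge0 (sval u.1 - sval v.1).
  split; first exact: reach_jump.
    by rewrite mulrDr; lra.
  by have := ler_distD (sval u.1) (sval p.1) (sval v.1); lra.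
- have [|k [a [pua ka tu]]] := IH; first by lra.
  exists k.+1, a; split=> /=.
  + by exists u.2, s, a; split=> //; rewrite mdistxx addr0.
  + by rewrite -natr1; lra.
  + by lra.
Qed.

Lemma warped_cone_reach (p q : @cone R Y) r m : 0 <= m -> m <= sval p.1 - r ->
  dG p q < r -> exists k a, reach k a p.2 q.2 /\ k%:R + m * a < r.
Proof.
move=> m0 mr /(warped_dist_chain dm hS cone_act_action)[c pq cr].
have [|k [a [pqa kc _]]] := cone_chain_reach pq m0; first by lra.
by exists k, a; split=> //; exact: le_lt_trans kc cr.
Qed.

End cone.

(** * Fibred embeddings from affine actions *)

Section compact_metric.
Context {R : realType} {Y : metricType R}.
Hypothesis hcompact : compact [set: Y].
Local Notation dist := (@mdist R Y).

Lemma open_mdist c e : open [set y | dist c y < e].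
Proof.
rewrite openE => y /= cy; apply/nbhs_ballP; exists (e - dist c y) => /=.
  by rewrite subr_gt0.
by move=> z; rewrite ballEmdist /=; have := metric_triangle c y z; lra.
Qed.

Lemma finite_net e : 0 < e ->
  exists s : seq Y, forall y, exists2 c, c \in s & dist c y < e.
Proof.
move=> e0; have [[y0 _]|Y0] := pselect (exists y : Y, True); last first.
  by exists [::] => y; exfalso; apply: Y0; exists y.
have : @compact (at_point y0) setT := hcompact; rewrite compact_cover.
move=> /(_ (at_point y0) setT (fun c => [set y | dist c y < e])).
case=> [c _|y _|D _ Dcov]; first exact: open_mdist.
  by exists y => //=; rewrite mdistxx.
exists (finmap.enum_fset D) => y; have [c cD cy] := Dcov y I.
by exists c.
Qed.

Lemma compact_unif_continuous (g : Y -> Y) : continuous g ->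
  forall e, 0 < e -> exists2 r, 0 < r &
    forall y z, dist y z <= r -> dist (g y) (g z) <= e.
Proof.
move=> gc e e0; have e20 : 0 < e / 2 by rewrite divr_gt0.
have : \forall r \near 0^'+, [set: Y] `<=`
    [set y | forall z, dist y z <= r -> dist (g y) (g z) <= e].
  move/compact_near_coveringP : hcompact; apply => y _.
  have : nbhs y [set x | ball (g y) (e / 2) (g x)].
    exact: (cvg_ballP _ _).1 (gc y) _ e20.
  case/nbhs_ballP => r /= r0 yr.
  (* Half of the radius, so that [u] near [y] and [z] near [u] both lie where [g] is close to
     [g y]. *)
  have r20 : 0 < r / 2 by rewrite divr_gt0.
  exists (ball y (r / 2), [set s | s < r / 2]) => /=.
    split; first exact: nbhsx_ballx.
    exact: nbhs_right_lt.
  move=> [u s] /= [yu sr] z uz.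
  have /yr : ball y r u.
    by move: yu; rewrite !ballEmdist /=; lra.
  have /yr : ball y r z.
    move: yu; rewrite !ballEmdist /=.
    by have := metric_triangle y u z; lra.
  rewrite /= !ballEmdist /= => yz gyu.
  by have := metric_triangle (g u) (g y) (g z); rewrite (metric_sym (g u) (g y)); lra.
move=> /(filterI (nbhs_right_gt 0))/filter_ex[r [r0 rP]].
by exists r => // y z; exact: rP.
Qed.

Lemma compact_displacement (g : Y -> Y) : continuous g ->
  (forall y, g y <> y) -> exists2 e, 0 < e & forall y, e < dist (g y) y.
Proof.
move=> gc gy.
have : \forall e \near 0^'+, [set: Y] `<=` [set y | e < dist (g y) y].
  move/compact_near_coveringP : hcompact; apply => y _.
  have d0 : 0 < dist (g y) y by rewrite mdist_gt0; apply/eqP.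
  (* Moving [y] to [u] costs less than [2 * r] of the displacement [4 * r], which leaves more than
     [r]. *)
  pose r := dist (g y) y / 4; have r0 : 0 < r by rewrite divr_gt0.
  have gyr := (cvg_ballP _ _).1 (gc y) _ r0.
  exists ([set u | ball (g y) r (g u) /\ ball y r u], [set s | s < r]) => /=.
    split; first by apply: filterI; [exact: gyr|exact: nbhsx_ballx].
    exact: nbhs_right_lt.
  move=> [u s] /= [[gu yu] sr]; move: gu yu; rewrite !ballEmdist /= => gu yu.
  have := metric_triangle (g y) (g u) y; have := metric_triangle (g u) u y.
  by rewrite (metric_sym u y); rewrite /r in sr gu yu *; lra.
move=> /(filterI (nbhs_right_gt 0))/filter_ex[e [e0 eP]].
by exists e => // y; exact: eP.
Qed.

Lemma compact_bounded_real (h : Y -> R) : continuous h ->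
  exists M, forall y, h y <= M.
Proof.
move=> hc.
have : \forall M \near +oo, [set: Y] `<=` [set y | h y <= M].
  move/compact_near_coveringP : hcompact; apply => y _.
  have := (cvg_ballP _ _).1 (hc y) _ ltr01 => hy.
  exists ([set u | ball (h y) 1 (h u)], [set M | h y + 1 <= M]) => /=.
    split; first exact: hy.
    by apply: nbhs_pinfty_ge; exact: num_real.
  move=> [u M] /= [yu yM]; move: yu; rewrite /ball /= => yu.
  by have := ler_norm (h u - h y); rewrite distrC; lra.
move=> /filter_ex[M MP]; by exists M => y; exact: MP.
Qed.

End compact_metric.

(** * The model Hilbert space and its affine action *)

Section span.
Context {R : realType} {E : lmodType R} (A : set E).

Definition span_pred : {pred E} := [pred x | `[< exists l : seq (R * E),
  (forall p, p \in l -> A p.2) /\ x = \sum_(p <- l) p.1 *: p.2 >]].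

Record span := Span { span_val : E ; spanP : span_val \in span_pred }.

HB.instance Definition _ := [isSub for span_val].
HB.instance Definition _ := [Choice of span by <:].

Lemma span_gen x : A x -> x \in span_pred.
Proof.
move=> Ax; apply/asboolP; exists [:: (1, x)]; rewrite big_seq1 scale1r.
by split=> // p; rewrite inE => /eqP ->.
Qed.

Lemma span_subproof : subsemimod_closed span_pred.
Proof.
split; first split.
- by apply/asboolP; exists [::]; rewrite big_nil.
- move=> _ _ /asboolP[l [lA ->]] /asboolP[k [kA ->]].
  apply/asboolP; exists (l ++ k); rewrite big_cat; split=> // p.
  by rewrite mem_cat => /orP[/lA|/kA].
- move=> a _ /asboolP[l [lA ->]]; apply/asboolP.
  exists [seq (a * p.1, p.2) | p <- l]; split=> [_ /mapP[p pl ->]|].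
    exact: (lA p pl).
  by rewrite big_map scaler_sumr; apply: eq_bigr => p _; rewrite scalerA.
Qed.

HB.instance Definition _ := GRing.SubChoice_isSubLmodule.Build R E
  span_pred span span_subproof.

Lemma span_stable (T : {linear E -> E}) : (forall x, A x -> A (T x)) ->
  forall x, x \in span_pred -> T x \in span_pred.
Proof.
move=> TA _ /asboolP[l [lA ->]]; apply/asboolP.
exists [seq (p.1, T p.2) | p <- l]; split=> [_ /mapP[p pl ->]|].
  exact: TA (lA p pl).
by rewrite big_map raddf_sum; apply: eq_bigr => p _ /=; rewrite linearZ.
Qed.

(** Defined for every [T]; the default [0] does not occur when [T] is linear and preserves [A]. *)
Definition span_restrict (T : E -> E) (x : span) : span := insubd 0 (T (span_val x)).

Lemma span_restrictE (T : {linear E -> E}) : (forall x, A x -> A (T x)) ->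
  forall x, span_val (span_restrict T x) = T (span_val x).
Proof.
move=> TA x; rewrite /span_restrict -[LHS]/(val _) val_insubd.
by rewrite span_stable// spanP.
Qed.

Lemma span_restrict_linear (T : {linear E -> E}) :
  (forall x, A x -> A (T x)) -> linear (span_restrict T).
Proof.
move=> TA a x y; apply: val_inj.
by rewrite /= !span_restrictE//= linearP.
Qed.

End span.

Section hilbert_norm.
Context {R : realType} {H : hilbertType R}.
Implicit Types x y z : H.

Lemma inner_ge0 x : 0 <= inner x x.
Proof. by rewrite -norm_inner sqr_ge0. Qed.

Definition inner_form : semi_inner H :=
  SemiInner innerC innerDl innerZl inner_ge0.

Lemma seminorm_inner x : seminorm inner_form x = `|x|.
Proof. by rewrite /seminorm /= -norm_inner sqrtr_sqr normr_id. Qed.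

End hilbert_norm.

Section sum_form.
Context {R : realType} {E H : hilbertType R} (A : set E).

(* The span of [A] replaces [E], which need not be separable. *)
Definition sum_space : lmodType R := (span A * R^o * H)%type.

Definition sum_inner (u v : sum_space) : R :=
  inner (span_val u.1.1) (span_val v.1.1) + u.1.2 * v.1.2 + inner u.2 v.2.

Fact sum_innerC u v : sum_inner u v = sum_inner v u.
Proof.
by rewrite /sum_inner innerC (mulrC u.1.2) (innerC u.2).
Qed.

Fact sum_innerDl u v w :
  sum_inner (u + v) w = sum_inner u w + sum_inner v w.
Proof.
rewrite /sum_inner /= !innerDl mulrDl; ring.
Qed.

Fact sum_innerZl a u v : sum_inner (a *: u) v = a * sum_inner u v.
Proof. by rewrite /sum_inner /= !innerZl -[_ *: _]/(a * _); ring. Qed.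

Fact sum_inner_ge0 u : 0 <= sum_inner u u.
Proof. by rewrite /sum_inner !addr_ge0 ?inner_ge0// -expr2 sqr_ge0. Qed.

Definition sum_form : semi_inner sum_space :=
  SemiInner sum_innerC sum_innerDl sum_innerZl sum_inner_ge0.

Lemma sum_formE u :
  sum_form u u = `|span_val u.1.1| ^+ 2 + u.1.2 ^+ 2 + `|u.2| ^+ 2.
Proof. by rewrite !norm_inner expr2. Qed.

End sum_form.

Section affine_actions.
Context {R : realType} {G : groupType} {H : hilbertType R}.
Variable alpha : G -> affine_iso H H.
Hypothesis alphaM : forall g h v, alpha (g * h)%g v = alpha g (alpha h v).

Lemma affine_act1 v : alpha 1%g v = v.
Proof.
by apply: (can_inj (affine_fwdK (alpha 1%g))); rewrite -alphaM mulg1.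
Qed.

Lemma affine_actE g v : alpha g v = affine_lin (alpha g) v + alpha g 0.
Proof. by rewrite /affine_fun raddf0 add0r. Qed.

Lemma affine_act_linB g v w : affine_lin (alpha g) (v - w) = alpha g v - alpha g w.
Proof.
rewrite raddfB /= (affine_actE g v) (affine_actE g w) opprD addrACA subrr.
by rewrite addr0.
Qed.

Lemma affine_act_lin1 v : affine_lin (alpha 1%g) v = v.
Proof. by rewrite -[v in LHS]subr0 affine_act_linB !affine_act1 subr0. Qed.

Lemma affine_act_linM g h v : affine_lin (alpha (g * h)%g) v =
  affine_lin (alpha g) (affine_lin (alpha h) v).
Proof.
by rewrite -[v in LHS]subr0 -[v in RHS]subr0 !affine_act_linB !alphaM.
Qed.

Lemma affine_act_cocycle g h :
  alpha (g * h)%g 0 = affine_lin (alpha g) (alpha h 0) + alpha g 0.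
Proof. by rewrite alphaM affine_actE. Qed.

(** Reduces distances between orbit points to the size of [alpha (h^-1 * g) 0], up to the norm of a
    linear part. *)
Lemma affine_act_orbitB g h : alpha g 0 - alpha h 0 =
  affine_lin (alpha h) (alpha (h^-1 * g)%g 0).
Proof.
by have := affine_act_cocycle h (h^-1 * g)%g; rewrite mulVKg => ->; rewrite addrK.
Qed.

End affine_actions.

Section model.
Context {R : realType} {Y : metricType R} {G : groupType}.
Variables (act : G -> Y -> Y) (hcompact : compact [set: Y]).
Context {E : hilbertType R}.
Variables (pi : G -> {linear E -> E}) (f : Y -> E).
Hypotheses (pi_rep : isometric_representation pi)
  (f_cont : forall e, 0 < e -> exists2 r, 0 < r &
    forall y z, mdist y z < r -> `|f y - f z| <= e)
  (f_equiv : forall g y, f (act g y) = pi g (f y)).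
Context {H0 : hilbertType R}.
Variables (alpha : G -> affine_iso H0 H0) (L0 : R).
Hypotheses (hsep : separable H0)
  (alphaM : forall g h v, alpha (g * h)%g v = alpha g (alpha h v))
  (alphaL : forall g, (affine_norm (alpha g) <= L0%:E)%E).

Let V := @sum_space R E H0 (range f).
Let B : semi_inner V := sum_form (range f).

Let pi_range g x : range f x -> range f (pi g x).
Proof. by move=> [y _ <-]; exists (act g y). Qed.

Let T (g : G) (u : V) : V :=
  (span_restrict (pi g) u.1.1, u.1.2, affine_lin (alpha g) u.2).

Let T_linear g : linear (T g).
Proof.
move=> a u v; rewrite /T.
congr (_, _, _); first exact: (span_restrict_linear (pi_range g)).
exact: linearP.
Qed.

Let Tl g : {linear V -> V} :=
  HB.pack (T g) (GRing.isLinear.Build R V V *:%R (T g) (T_linear g)).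

Let fspan y : span (range f) := Span (span_gen (imageT f y)).

Let iota (t : R) (y : Y) : V := (t *: fspan y, t, 0).

(** The generators are [f] at the points of finite nets of [Y], the unit of [R], and a countable
    dense subset of [H0]. *)
Let V_separable : exists (J : countType) (a : J -> V), forall v, in_closed_span B a v.
Proof.
have [D [/countable_injP[p pinj] Ddense]] := hsep.
have net n : exists s : seq Y, forall y, exists2 c, c \in s & mdist c y < n.+1%:R^-1.
  by apply: finite_net => //; rewrite invr_gt0.
have /choice[s sP] := net.
(* The pair gives the index of a net and a position in it; positions beyond the net yield [0]. *)
pose a1 (j : nat * nat) : V :=
  if onth (s j.1) j.2 is Some y then (fspan y, 0, 0) else 0.
pose a (j : (nat * nat) + unit + nat) : V := match j with
  | inl (inl k) => a1 k
  | inl (inr _) => (0, 1, 0)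
  | inr n => (0, 0, xget 0 [set h | D h /\ p h = n])
  end.
exists ((nat * nat) + unit + nat)%type, a => v.
have hf y : in_closed_span B a (fspan y, 0, 0).
  apply: in_closed_span_closed => e e0.
  have [r r0 fr] := f_cont e0.
  have [n nr] : exists n, n.+1%:R^-1 < r.
    by have [n _ /(_ n (leqnn n))] := near_infty_natSinv_lt (PosNum r0); exists n.
  have [c cs cy] := sP n y.
  exists (fspan c, 0, 0).
    have -> : (fspan c, 0, 0) = a (inl (inl (n, index c (s n)))).
      rewrite /= /a1 /= (_ : onth _ _ = Some c)//.
      by rewrite onthE (nth_map c) ?index_mem// nth_index.
    exact: in_closed_span_gen.
  rewrite seminorm_le ?(ltW e0)// sum_formE /= !subr0 normr0 !expr0n /= !addr0.
  rewrite ler_sqr ?nnegrE ?(ltW e0)// distrC fr// (lt_trans cy)//.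
have hspan x : in_closed_span B a (x, 0, 0).
  have /asboolP[l [lA xE]] := spanP x.
  have : forall x : span (range f), span_val x = \sum_(p <- l) p.1 *: p.2 ->
      in_closed_span B a (x, 0, 0).
    elim: l lA {xE} => [|[c z] l IH] lA {}x.
      rewrite big_nil => x0; rewrite (_ : x = 0); last exact: val_inj.
      have -> : (0, 0, 0) = 0 *: a (inl (inr tt)) :> V by rewrite scale0r.
      exact/in_closed_spanZ/in_closed_span_gen.
    have [y _ yz] := lA (c, z) (mem_head _ _); rewrite /= in yz.
    rewrite big_cons /= -yz => xE.
    have -> : (x, 0, 0) = c *: (fspan y, 0, 0) + (x - c *: fspan y, 0, 0) :> V.
      by congr (_, _, _); rewrite /= ?scaler0 ?addr0// addrC subrK.
    apply: in_closed_spanD; first exact: in_closed_spanZ.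
    apply: IH => [q ql|]; first by apply: lA; rewrite inE ql orbT.
    by rewrite /= xE addrC addKr.
  exact.
have hH h : in_closed_span B a (0, 0, h).
  apply: in_closed_span_closed => e e0.
  have [||k [hk Dk]] := Ddense (ball h e).
  - by exists h; exact: ballxx.
  - exact: (@ball_open R H0 h e).
  exists (0, 0, k); last first.
    rewrite seminorm_le ?(ltW e0)// sum_formE /= !subr0 normr0 !expr0n /= !add0r.
    by rewrite ler_sqr ?nnegrE ?(ltW e0)//; move: hk; rewrite -ball_normE => /ltW.
  have -> : (0, 0, k) = a (inr (p k)).
    rewrite /=; congr (_, _, _); case: xgetP => [x _ [Dx px]|/(_ k)]; last by case.
    by apply/esym/pinj; rewrite ?inE.
  exact: in_closed_span_gen.
case: v => [[x c] h].
have -> : (x, c, h) = (x, 0, 0) + c *: a (inl (inr tt)) + (0, 0, h).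
  congr (_, _, _) => /=; rewrite ?scaler0 ?addr0 ?add0r//.
  by rewrite -[_ *: _]/(c * 1) mulr1.
by apply: in_closed_spanD => //; apply: in_closed_spanD => //;
  exact/in_closed_spanZ/in_closed_span_gen.
Qed.

(** The final identity splits the distance into three parts, which record the position in [Y], the
    level in the cone and the group element. *)
Lemma model_action : exists (H : hilbertType R) (i : R -> Y -> H)
    (beta : G -> affine_iso H H) (L : R),
  [/\ separable H, 0 < L,
      forall g h x, beta (g * h)%g x = beta g (beta h x),
      forall g, affine_iso_bounded L (beta g) /\
                forall x, affine_inv (beta g) x = beta g^-1%g x &
      forall g h t u y z, `|beta g (i t y) - beta h (i u z)| ^+ 2 =
        `|t *: f (act g y) - u *: f (act h z)| ^+ 2 + (t - u) ^+ 2 +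
        `|alpha g 0 - alpha h 0| ^+ 2].
Proof.
(* The action is isometric on the first two summands and has norm at most [L0] on the third. *)
have L1 : 0 < Num.max 1 L0 by rewrite lt_max ltr01.
have ThE g u : span_val (T g u).1.1 = pi g (span_val u.1.1).
  exact: (span_restrictE (pi_range g)).
pose b g : V := (0, 0, alpha g 0).
have null (u w : V) : span_val u.1.1 = span_val w.1.1 -> u.1.2 = w.1.2 ->
    u.2 = w.2 -> seminorm B (u - w) = 0.
  case: u w => [[x r] k] [[x' r'] k'] /= /val_inj -> -> ->.
  by rewrite subrr seminorm0.
have [|g u|u|g h u|g h|beta [betaE betaM betaL betaV]] :=
    @affine_action_extension _ _ B G Tl b (Num.max 1 L0).
- exact: ltW.
- rewrite seminorm_le ?mulr_ge0 ?seminorm_ge0// ?(ltW L1)// exprMn sqr_seminorm.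
  rewrite !sum_formE ThE pi_rep.2 !mulrDr.
  have M1 : 1 <= Num.max 1 L0 ^+ 2 by rewrite exprn_ege1// le_max lexx.
  apply: lerD; first apply: lerD.
  + by rewrite ler_peMl ?sqr_ge0.
  + by rewrite ler_peMl ?sqr_ge0.
  + rewrite -exprMn ler_sqr ?nnegrE ?mulr_ge0 ?(ltW L1)//.
    rewrite (le_trans (opnormP (alphaL g) _))// ler_wpM2r// le_max lexx orbT//.
- by apply: null; rewrite ?ThE ?pi_rep.1.1//= (affine_act_lin1 alphaM).
- by apply: null; rewrite ?ThE ?pi_rep.1.2//= (affine_act_linM alphaM).
- apply: null => /=; rewrite ?addr0//; last exact: affine_act_cocycle.
  by rewrite (span_restrictE (pi_range g)); exact: (esym (raddf0 (pi g))).
have [J [a aP]] := V_separable.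
exists (completion B), (fun t y => cemb B (iota t y)), beta, (Num.max 1 L0).
split=> //; first exact: separable_completion aP.
move=> g h t u y z; rewrite !betaE -[_ - _]raddfB normr_cemb sqr_seminorm sum_formE.
congr (_ + _ + _).
- congr (`|_| ^+ 2); rewrite /= addr0 addr0.
  rewrite -[LHS]/(span_val (T g (iota t y)).1.1 - span_val (T h (iota u z)).1.1).
  by rewrite !ThE !f_equiv /= !linearZ.
- by rewrite /= !addr0.
- by congr (`|_| ^+ 2); rewrite /= !raddf0 !add0r.
Qed.

End model.

(** * Lower control functions *)

Section control.
Context {R : realType}.

(** A generalized inverse: [rho d] is the infimum of the values [N] related to some distance at
    least [d]. *)
Lemma control_function_below (P : R -> R -> Prop) :
  (forall N, exists D, forall d N', 0 <= N' -> N' <= N -> P d N' -> d <= D) ->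
  exists2 rho : R -> R, control_function rho &
    forall d N, 0 <= N -> P d N -> rho d <= N.
Proof.
move=> hP.
(* The alternative [N = d'] keeps the set nonempty; as [d'] is at least [d], it does not spoil
   divergence. *)
pose A d := [set N | 0 <= N /\ exists2 d', d <= d' & P d' N \/ N = d'].
have Alb d : has_lbound (A d) by exists 0 => N [].
have Ane d : A d !=set0.
  exists (Num.max d 0); split; first by rewrite le_max lexx orbT.
  by exists (Num.max d 0); [rewrite le_max lexx|right].
exists (fun d => inf (A d)); last first.
  by move=> d N N0 dN; apply: ge_inf => //; split=> //; exists d => //; left.
split=> [a b a0 ab|].
  apply: lb_le_inf => // N [N0 [d' bd' PN]]; apply: ge_inf => //.
  by split=> //; exists d' => //; exact: le_trans bd'.
apply/cvgryPge => M; have [D DP] := hP M.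
near=> t; apply: lb_le_inf => // N [N0 [d' td' [PN|->]]].
  rewrite leNgt; apply/negP => /ltW NM; have := DP _ _ N0 NM PN.
  apply/negP; rewrite -ltNge (lt_le_trans _ td')//.
  by near: t; apply: nbhs_pinfty_gt; exact: num_real.
apply: le_trans td'.
by near: t; apply: nbhs_pinfty_ge; exact: num_real.
Unshelve. all: by end_near. Qed.

End control.

(** * Trivializing the field over small sets *)

Section fibred_embedding.
Context {R : realType} {G : groupType} (S : seq G) {Y : metricType R}.
Variable act : G -> Y -> Y.
Hypotheses (hS : symmetric_generating S) (hact : is_action act)
  (hcont : forall g, continuous (act g)) (hcompact : compact [set: Y])
  (hdiam : (diam (@mdist R Y) [set: Y] <= 2%:E)%E) (hfree : free_action act).
Local Notation dist := (@mdist R Y).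
Local Notation X := (@cone R Y).
Local Notation dG := (warped_cone_dist act S : X -> X -> R).

Lemma free_displacement k : exists2 e : R, 0 < e &
  forall g y, g \in wball S k -> g != 1%g -> e < dist (act g y) y.
Proof.
suff [e e0 eP] : exists2 e : R, 0 < e &
    forall g, g \in wball S k -> g != 1%g -> forall y, e < dist (act g y) y.
  by exists e => // g y gk g1; exact: eP.
elim: (wball S k) => [|g s [e e0 IH]]; first by exists 1.
have [->|g1] := eqVneq g 1%g.
  by exists e => // h; rewrite inE => /orP[/eqP ->|/IH //]; rewrite eqxx.
have [|e' e'0 e'P] := compact_displacement hcompact (@hcont g).
  by move=> y /hfree g1'; rewrite g1' eqxx in g1.
exists (Num.min e e') => [|h]; first by rewrite lt_min e0.
by rewrite inE => /orP[/eqP -> _ y|hs h1 y]; rewrite gt_min ?e'P ?orbT// IH.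
Qed.

Context {E : hilbertType R} (pi : G -> {linear E -> E}) (f : Y -> E).
Variables (c C M : R).
Hypotheses (pi_rep : isometric_representation pi)
  (f_equiv : forall g y, f (act g y) = pi g (f y))
  (c0 : 0 < c) (C0 : 0 < C) (fM : forall y, `|f y| <= M)
  (f_ge : forall y z, c * dist y z <= `|f y - f z|)
  (f_le : forall y z, `|f y - f z| <= C * dist y z).

Let f_isom g y z : `|f (act g y) - f (act g z)| = `|f y - f z|.
Proof. by rewrite !f_equiv -raddfB pi_rep.2. Qed.

(** Every group element preserves [|f y - f z|], so later moves do not enlarge earlier jumps and the
    errors simply add up. *)
Lemma reach_isometric k a y z : reach act S k a y z ->
  exists2 g, g \in wball S k & `|f (act g y) - f z| <= C * a.
Proof.
elim: k a z => [|k IH] a z /=.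
  move=> yz; exists 1%g; first exact: wball1.
  by rewrite hact.1 (le_trans (f_le _ _))// ler_pM2l.
move=> [u [s [b [sS /IH[g gk yu] ba]]]]; exists (s * g)%g; first exact: wballS.
rewrite hact.2 -(subrKA (f (act s u))) (le_trans (ler_normD _ _))// f_isom.
have := ler_wpM2l (ltW C0) ba; rewrite mulrDr.
by have := f_le (act s u) z; lra.
Qed.

Lemma warped_cone_near (p q : X) r : 0 <= r -> 2 * (r + 1) <= sval p.1 ->
  dG p q < r -> exists k g, [/\ g \in wball S k, k%:R <= dG p q + 1 &
    sval p.1 * `|f (act g p.2) - f q.2| <= 2 * C * (dG p q + 1)].
Proof.
move=> r0 rp; set d := dG p q => pqr.
have d0 : 0 <= d by have [h _ _ _] := warped_cone_metric act S hdiam; exact: h.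
(* A path of cost below [d + 1] costs less than half of the level of [p], so it stays above that
   half. *)
have [|||k [a [pqa kma]]] :=
    @warped_cone_reach _ _ _ _ _ hS hact hdiam p q (d + 1) (sval p.1 / 2).
- by rewrite divr_ge0// (le_trans ler01)//; case: (p.1).
- by lra.
- by rewrite -/d ltrDl.
have a0 := reach_ge0 pqa; have [g gk fg] := reach_isometric pqa.
have p10 : 0 <= sval p.1 by rewrite (le_trans ler01)//; case: (p.1).
have pa0 : 0 <= sval p.1 * a by rewrite mulr_ge0.
exists k, g; split=> //; first by lra.
apply: le_trans (ler_wpM2l p10 fg) _.
have k0 : 0 <= k%:R :> R by [].
rewrite mulrCA -mulrA (mulrC 2) -mulrA ler_pM2l//.
by lra.
Qed.

Context {H0 : hilbertType R} (alpha : G -> affine_iso H0 H0) (L0 : R).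
Hypotheses (alphaM : forall g h v, alpha (g * h)%g v = alpha g (alpha h v))
  (L00 : 0 < L0) (alphaL : forall g, (affine_norm (alpha g) <= L0%:E)%E)
  (alphaP : forall B : set H0, bounded_set B ->
    finite_set [set g | (alpha g @` B) `&` B !=set0]).

Let alpha_growth k : R := \sum_(g <- wball S k) `|alpha g 0|.

Let alpha_growthP k g : g \in wball S k -> `|alpha g 0| <= alpha_growth k.
Proof.
by move=> gk; rewrite /alpha_growth (big_rem g)//= lerDl sumr_ge0.
Qed.

Let alpha_growth_le k l : (k <= l)%N -> alpha_growth k <= alpha_growth l.
Proof.
move=> /subnK <-; elim: (l - k)%N => // m IH; apply: le_trans IH _.
by rewrite addSn /alpha_growth [wball _ (_ + _).+1]/wball big_cat lerDl sumr_ge0.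
Qed.

(** Dominates the sum of the bounds for the three components of the model:
    [2 * C * (d + 1) + d * M], then [d], then the growth of the cocycle of [alpha]. *)
Let rho_p (d : R) : R :=
  (2 * C + M + 1) * (d + 1) + L0 * alpha_growth (Num.truncn (d + 1)).

Let rho_p_control (y0 : Y) : control_function rho_p.
Proof.
have M0 : 0 <= M := le_trans (normr_ge0 _) (fM y0).
have CM : 0 < 2 * C + M + 1 by move: C0 M0; lra.
split=> [a b a0 ab|].
  apply: lerD; first by rewrite ler_pM2l// lerD2r.
  by rewrite ler_pM2l// alpha_growth_le// le_truncn// lerD2r.
apply/cvgryPge => A; near=> t.
have t0 : 0 <= t by near: t; apply: nbhs_pinfty_ge; exact: num_real.
have tA : A <= t by near: t; apply: nbhs_pinfty_ge; exact: num_real.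
have h1 : 0 <= L0 * alpha_growth (Num.truncn (t + 1)).
  by rewrite mulr_ge0 ?(ltW L00)// sumr_ge0.
have h2 : 0 <= (2 * C + M) * (t + 1) by rewrite mulr_ge0 ?addr_ge0 ?mulr_ge0 ?(ltW C0).
by rewrite /rho_p mulrDl mul1r; lra.
Unshelve. all: by end_near. Qed.

(** All three components are bounded in terms of [N], with [h] the element relating [p] to [q]. No
    scale [r] appears, so one lower control function serves every scale. *)
Let lower_relation (d N : R) : Prop := exists (p q : X) (h : G),
  [/\ d = dG p q, `|sval p.1 *: f (act h p.2) - sval q.1 *: f q.2| <= N,
      `|sval p.1 - sval q.1| <= N & `|alpha h 0| <= L0 * N].

(** Properness of [alpha] confines [h] to a word ball, so moving by [h] has bounded cost; the other
    two bounds then control the jump that remains. *)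
Let lower_bound : exists2 rho : R -> R, control_function rho &
    forall d N, 0 <= N -> lower_relation d N -> rho d <= N.
Proof.
apply: control_function_below => N.
have [k kP] : exists k, forall g, `|alpha g 0| <= L0 * N -> g \in wball S k.
  have [N0|N0] := leP 0 N; last first.
    exists 0%N => g /(le_trans (normr_ge0 _)).
    by rewrite pmulr_rge0// leNgt N0.
  have [|k kP] := @finite_group_setP _ _ hS _ (alphaP (B := [set v | `|v| <= L0 * N]) _).
    by exists (L0 * N); split; [exact: num_real|move=> x /ltW Nx y /= /le_trans; exact].
  exists k => g gN; apply: kP; exists (alpha g 0); split=> //=.
  by exists 0 => //=; rewrite normr0 mulr_ge0// ltW.
(* The terms pay for the move by [h], the change of level and the jump in [Y]. Putting both vectors
   at the level of [p] adds [(t - u) *: f q.2], of norm at most [N * M]. *)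
exists (k%:R + N + (N + N * M) / c) => _ N' N'0 N'N [p [q [h [-> fpq tpq ah]]]].
have hk : h \in wball S k by apply: kP; rewrite (le_trans ah)// ler_pM2l.
apply: le_trans (warped_cone_dist_le hact hdiam p q hk) _.
rewrite /cone_dist /= -!addrA lerD2l; apply: lerD; first exact: le_trans tpq N'N.
have p10 : 0 <= sval p.1 by rewrite (le_trans ler01)//; case: (p.1).
have M0 : 0 <= M := le_trans (normr_ge0 _) (fM p.2).
apply: le_trans (_ : _ <= sval p.1 * dist (act h p.2) q.2) _.
  by rewrite ler_wpM2r ?mdist_ge0// ge_min lexx.
rewrite ler_pdivlMr// -mulrA (mulrC _ c).
apply: le_trans (ler_wpM2l p10 (f_ge _ _)) _.
rewrite -[X in X * _](ger0_norm p10) -normrZ scalerBr.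
rewrite (_ : _ - _ = (sval p.1 *: f (act h p.2) - sval q.1 *: f q.2) -
    (sval p.1 - sval q.1) *: f q.2); last first.
  by rewrite scalerBl opprB addrA subrK.
apply: le_trans (ler_normB _ _) _; rewrite normrZ.
apply: lerD; first exact: le_trans fpq N'N.
by apply: ler_pM => //; exact: le_trans tpq N'N.
Qed.

Lemma fibred_embedding : separable H0 ->
  ub_fibred_coarse_embedding dG.
Proof.
move=> hsep.
have f_cont e : 0 < e -> exists2 r, 0 < r &
    forall y z, dist y z < r -> `|f y - f z| <= e.
  move=> e0; exists (e / C); first by rewrite divr_gt0.
  by move=> y z yz; rewrite (le_trans (f_le _ _))// mulrC -ler_pdivlMr// ltW.
have [H [i [beta [L [Hsep L_gt0 betaM betaL betaE]]]]] :=
  model_action hcompact pi_rep f_cont f_equiv hsep alphaM alphaL.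
have [rho_m rho_mc rho_mP] := lower_bound.
have betaV g x : affine_inv (beta g) x = beta g^-1%g x := (betaL g).2 x.
have beta1 x : beta 1%g x = x := affine_act1 betaM x.
have C_ge0 := ltW C0; have L0_ge0 := ltW L00.
(* An empty cone is treated apart, because the choices below use a default point [p0]. *)
have [[p0 _]|noX] := pselect (exists p : X, True); last first.
  exists H, L, (fun _ => H), (fun p => i (sval p.1) p.2), id, id.
  have idc : control_function (@id R) by split=> //; exact: cvg_id.
  split; [exact: Hsep|exact: L_gt0|exact: idc|exact: idc|].
  - move=> r r0; exists set0.
      by apply: le_lt_trans (ltry 0); apply: ge_ereal_sup => _ [[p q] [[]]].
    exists (fun _ _ _ => beta 1%g); split=> [D x|D x|D1 D2 [x]].
    + by exfalso; apply: noX; exists x.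
    + by exfalso; apply: noX; exists x.
    + by exfalso; apply: noX; exists x.
have M_ge0 : 0 <= M := le_trans (normr_ge0 _) (fM p0.2).
exists H, L, (fun _ => H), (fun p => i (sval p.1) p.2), rho_m, rho_p.
split; [exact: Hsep|exact: L_gt0|exact: rho_mc|exact: rho_p_control p0.2|].
move=> r r_gt0.
have r1 : 0 < r + 1 by rewrite addr_gt0.
pose k := Num.truncn (r + 1).
(* Uniqueness compares [g] with [h * h'], all three of length at most [k]; the quotient has length
   at most [3 * k]. *)
have [e e0 eP] := free_displacement (k + (k + k)).
(* The second term meets the condition of [warped_cone_near]; the third keeps three errors [eta]
   below [c * e], the least displacement seen through [f]. *)
pose T : R := 1 + 2 * (r + 1) + 6 * C * (r + 1) / (c * e).
have T0 : 0 < T.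
  by rewrite !addr_gt0// ?mulr_gt0// invr_gt0 mulr_gt0.
have T2 : 2 * (r + 1) <= T.
  rewrite /T addrAC lerDr addr_ge0// divr_ge0// ?mulr_ge0// ltW//.
pose eta := 2 * C * (r + 1) / T.
have eta3 : 3 * eta < c * e.
  have ceK : c * e * (6 * C * (r + 1) / (c * e)) = 6 * C * (r + 1).
    by rewrite mulrC divfK// mulf_neq0// gt_eqF.
  rewrite /eta mulrA ltr_pdivrMr// /T (mulrDr (c * e)) ceK.
  have : 0 < c * e * (1 + 2 * (r + 1)) by rewrite !mulr_gt0// addr_gt0// mulr_gt0.
  by lra.
pose K : set X := [set p | sval p.1 < T].
exists K.
  apply: (@le_lt_trans _ _ (3 * T)%:E); last exact: ltry.
  apply: ge_ereal_sup => _ [[p q] [/= pT qT] <-]; rewrite lee_fin.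
  apply: le_trans (warped_dist_le _ _ (cone_dist_metric hdiam) _ _) _.
  rewrite /cone_dist /=; move: pT qT; rewrite /K /=.
  case: p.1 q.1 => [t t1] [u u1] /= tT uT.
  have d2 : dist p.2 q.2 <= 2.
    rewrite -lee_fin; apply: le_trans hdiam; apply: ereal_sup_ubound.
    by exists (p.2, q.2).
  have : Num.min t u * dist p.2 q.2 <= T * 2.
    apply: ler_pM => //; first by rewrite le_min !(le_trans ler01).
      exact: mdist_ge0.
    by rewrite ge_min (ltW tT).
  have : `|t - u| <= T by rewrite ler_norml; apply/andP; split; lra.
  by lra.
pose near (p q : X) (g : G) :=
  g \in wball S k /\ `|f (act g p.2) - f q.2| <= eta.
have near_exists p q : ~ K p -> dG p q < r -> exists g l, [/\ near p q g,
    g \in wball S l, l%:R <= dG p q + 1 &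
    sval p.1 * `|f (act g p.2) - f q.2| <= 2 * C * (dG p q + 1)].
  move=> /negP; rewrite -leNgt => Tp pqr.
  have [l [g [gl ld fg]]] := warped_cone_near (ltW r_gt0) (le_trans T2 Tp) pqr.
  exists g, l; split=> //; split.
    apply: sub_wball gl; rewrite -(@natrK R l) le_truncn//.
    by rewrite (le_trans ld)// lerD2r ltW.
  rewrite /eta ler_pdivlMr// mulrC (le_trans (ler_wpM2r (normr_ge0 _) Tp))//.
  rewrite (le_trans fg)// ler_pM2l ?mulr_gt0// lerD2r ltW//.
(* The images under [f] of [h h' p], [h q], [o] and [g p] are successively [eta]-close. A nontrivial
   [h h' g^-1] would then displace [g p] by less than [e]. *)
have near_unique p q o g h h' :
    near p o g -> near q o h -> near p q h' -> g = (h * h')%g.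
  move=> [gk fg] [hk fh] [h'k fh'].
  have [//|gh] := eqVneq g (h * h')%g; exfalso.
  have /(_ (act g p.2)) := eP (h * (h' * g^-1))%g.
  rewrite -!hact.2 -!mulgA mulVg mulg1 !wballM ?(wballV hS)// => /(_ isT).
  have -> : (h * (h' * g^-1))%g != 1%g.
    by rewrite mulgA -(mulgV g) (inj_eq (mulIg _)) eq_sym.
  move=> /(_ isT); apply/negP; rewrite -leNgt -(ler_pM2l c0).
  apply: le_trans (f_ge _ _) (le_trans _ (ltW eta3)).
  rewrite (_ : 3 * eta = eta + eta + eta); last by ring.
  rewrite -(subrKA (f o.2)) (le_trans (ler_normD _ _))// lerD//; last by rewrite distrC.
  rewrite -(subrKA (f (act h q.2))) (le_trans (ler_normD _ _))// lerD//.
  by rewrite hact.2 f_isom.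
have small_lt (D : small_set dG K r) p q : sval D p -> sval D q -> dG p q < r.
  move=> Dp Dq; rewrite -lte_fin; apply: le_lt_trans (svalP D).2.
  by apply: ereal_sup_ubound; exists (p, q).
have outK (D : small_set dG K r) p : sval D p -> ~ K p := (svalP D).1 p.
have /choice[base baseP] (D : small_set dG K r) :
    exists o : X, forall p, sval D p -> sval D o.
  have [[b Db]|D0] := pselect (exists b, sval D b); first by exists b.
  by exists p0 => p Dp; exfalso; apply: D0; exists p.
pose sel (D : small_set dG K r) p := xget 1%g [set g | near p (base D) g].
have selP D p : sval D p -> near p (base D) (sel D p).
  move=> Dp; rewrite /sel; case: xgetP => [g _ //|nog]; exfalso.
  have [g [l [ng _ _ _]]] := near_exists p (base D) (outK _ _ Dp)
    (small_lt _ _ _ Dp (baseP _ _ Dp)).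
  exact: nog ng.
exists (fun D p _ => beta (sel D p)); split.
- by move=> D p _; exact: (betaL _).1.
- move=> D p q Dp Dq.
  have [h [l [npq hl ld fh]]] := near_exists p q (outK _ _ Dp) (small_lt _ _ _ Dp Dq).
  have selE := near_unique _ _ _ _ _ _ (selP _ _ Dp) (selP _ _ Dq) npq.
  set N := `|_|; set d := dG p q in ld fh *.
  have d0 : 0 <= d by have [d0 _ _ _] := warped_cone_metric act S hdiam; exact: d0.
  (* Since [sel D p = sel D q * h], the common factor drops out of the [E] component, where it acts
     isometrically. *)
  have NE : N ^+ 2 = `|sval p.1 *: f (act h p.2) - sval q.1 *: f q.2| ^+ 2 +
      (sval p.1 - sval q.1) ^+ 2 +
      `|alpha (sel D p) 0 - alpha (sel D q) 0| ^+ 2.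
    rewrite /N betaE; congr (_ ^+ 2 + _ + _).
    rewrite selE hact.2 !(f_equiv (sel D q)) -!linearZ -raddfB.
    exact: pi_rep.2.
  have N0 : 0 <= N := normr_ge0 _.
  have le_sqr x : 0 <= x -> x ^+ 2 <= N ^+ 2 -> x <= N.
    by move=> x0; rewrite ler_sqr ?nnegrE.
  have ahE : alpha (sel D p) 0 - alpha (sel D q) 0 =
      affine_lin (alpha (sel D q)) (alpha h 0).
    by rewrite (affine_act_orbitB alphaM) selE mulKg.
  have a1 := sqr_ge0 `|sval p.1 *: f (act h p.2) - sval q.1 *: f q.2|.
  have a2 := sqr_ge0 (sval p.1 - sval q.1).
  have a3 := sqr_ge0 `|alpha (sel D p) 0 - alpha (sel D q) 0|.
  apply/andP; split.
    apply: rho_mP => //; exists p, q, h; split=> //.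
    + by apply: le_sqr => //; rewrite NE; lra.
    + by apply: le_sqr => //; rewrite NE real_normK ?num_real//; lra.
    + have : `|alpha (sel D p) 0 - alpha (sel D q) 0| <= N.
        by apply: le_sqr => //; rewrite NE; lra.
      rewrite ahE => aN.
      (* On [H0] the common factor must be undone by its inverse, which costs the factor [L0] in
         [lower_relation]. *)
      rewrite -[alpha h 0](affine_act_lin1 alphaM) -(mulVg (sel D q)).
      rewrite (affine_act_linM alphaM).
      apply: le_trans (opnormP (alphaL _) _) _.
      by rewrite ler_pM2l.
  have b1 : `|sval p.1 *: f (act h p.2) - sval q.1 *: f q.2| <=
      2 * C * (d + 1) + d * M.
    rewrite (_ : _ - _ = sval p.1 *: (f (act h p.2) - f q.2) +
      (sval p.1 - sval q.1) *: f q.2); last first.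
      by rewrite scalerBr scalerBl addrA subrK.
    apply: le_trans (ler_normD _ _) _; rewrite !normrZ; apply: lerD.
      by rewrite ger0_norm ?(le_trans ler01)//; case: (p.1).
    by apply: ler_pM => //; exact: warped_cone_dist_ge.
  have b2 : `|sval p.1 - sval q.1| <= d by exact: warped_cone_dist_ge.
  have b3 : `|alpha (sel D p) 0 - alpha (sel D q) 0| <=
      L0 * alpha_growth (Num.truncn (d + 1)).
    rewrite ahE (le_trans (opnormP (alphaL _) _))// ler_pM2l//.
    rewrite (le_trans (alpha_growthP hl))// alpha_growth_le//.
    by rewrite -(@natrK R l) le_truncn.
  rewrite /rho_p; apply: (@le_trans _ _ (`|sval p.1 *: f (act h p.2) - sval q.1 *: f q.2| +
    `|sval p.1 - sval q.1| + `|alpha (sel D p) 0 - alpha (sel D q) 0|)); last first.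
    have -> : (2 * C + M + 1) * (d + 1) = 2 * C * (d + 1) + d * M + d + (M + 1) by ring.
    by lra.
  have sum3 (x y z : R) : 0 <= x -> 0 <= y -> 0 <= z ->
      x ^+ 2 + y ^+ 2 + z ^+ 2 <= (x + y + z) ^+ 2.
    move=> x0 y0 z0; have : 0 <= x * y + (x + y) * z.
      by rewrite addr_ge0 ?mulr_ge0 ?addr_ge0.
    by rewrite !expr2; lra.
  rewrite -ler_sqr ?nnegrE ?addr_ge0// NE -[(_ - _) ^+ 2]real_normK ?num_real//.
  exact: sum3.
- move=> D1 D2 [q [D1q D2q]].
  (* For [p] in both sets, [sel D1 p] and [sel D2 p] arise from their values at [q] by the same
     right factor, so this quotient does not depend on the point. *)
  exists (beta (sel D1 q * (sel D2 q)^-1)%g); first exact: (betaL _).1.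
  move=> p D1p D2p h; rewrite betaV -betaM.
  have [g [l [npq _ _ _]]] := near_exists p q (outK _ _ D1p) (small_lt _ _ _ D1p D1q).
  have E1 := near_unique _ _ _ _ _ _ (selP _ _ D1p) (selP _ _ D1q) npq.
  have E2 := near_unique _ _ _ _ _ _ (selP _ _ D2p) (selP _ _ D2q) npq.
  by rewrite E1 E2 invgM -mulgA mulVKg.
Qed.

End fibred_embedding.

(** * Affine actions from fibred embeddings *)

Section trivialised_section.
Context {R : realType} {X : Type} (d : X -> X -> R).

(* The section [s] read in the trivialization over [C]. *)
Lemma trivialised_section : ub_fibred_coarse_embedding d ->
  exists (H : hilbertType R) (L : R) (rho_m rho_p : R -> R),
  [/\ 0 < L, control_function rho_m, control_function rho_p &
  forall r, 0 < r -> exists2 K : set X, (diam d K < +oo)%E &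
  exists v : set X -> X -> H,
  let small C := C `<=` ~` K /\ (diam d C < r%:E)%E in
  (forall C x y, small C -> C x -> C y ->
    rho_m (d x y) <= `|v C x - v C y| <= rho_p (d x y)) /\
  (forall C D, small C -> small D -> C `&` D !=set0 ->
    exists2 T : {linear H -> H}, forall h, `|T h| <= L * `|h| &
    forall x y, C x -> D x -> C y -> D y ->
      v C x - v C y = T (v D x - v D y))].
Proof.
move=> [H [L [Hx [s [rho_m [rho_p [_ L0 rm rp emb]]]]]]].
exists H, L, rho_m, rho_p; split=> // r /emb[K Kb [t [tL tP tC]]].
exists K => //.
pose small C := C `<=` ~` K /\ (diam d C < r%:E)%E.
(* Made total, so that later statements carry no membership proofs; the value [0] is a default
   outside small sets. *)
pose v (C : set X) (x : X) : H :=
  if pselect (small C) is left sC then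
    if pselect (C x) is left Cx then t (exist _ C sC) x Cx (s x) else 0
  else 0.
have vE C x (sC : small C) (Cx : C x) : v C x = t (exist _ C sC) x Cx (s x).
  rewrite /v; case: pselect => // sC'; case: pselect => // Cx'.
  by rewrite (Prop_irrelevance sC' sC) (Prop_irrelevance Cx' Cx).
exists v; split=> [C x y sC Cx Cy|C D sC sD CD].
  by rewrite (vE _ _ sC Cx) (vE _ _ sC Cy).
have [t12 t12L t12E] := tC (exist _ C sC) (exist _ D sD) CD.
exists (affine_lin t12).
  exact: opnormP ((affine_iso_boundedP _ _).1 t12L).1.
have vCE x : C x -> D x -> v C x = t12 (v D x).
  move=> Cx Dx; rewrite (vE _ _ sC Cx) (vE _ _ sD Dx) -(t12E x Cx Dx).
  by rewrite (affine_fwdK (t (exist _ D sD) x Dx)).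
move=> x y Cx Dx Cy Dy; rewrite vCE// vCE// /affine_fun.
by rewrite raddfB opprD addrACA subrr addr0.
Qed.

End trivialised_section.

(** * Measurability of finite codes *)

Section cells.
Context {R : realType} {Y : metricType R} (y0 : Y).
Local Notation dist := (@mdist R Y).

Lemma measurable_find (s : seq Y) (e : R) (i : nat) :
  measurable ([set y | find (fun c => dist c y < e) s = i] : set (borel y0)).
Proof.
elim: s i => [|c s IH] i /=.
  have [->|i0] := eqVneq i 0%N.
    by rewrite (_ : [set _ | _] = setT); [exact: measurableT|apply/seteqP; split].
  rewrite (_ : [set _ | _] = set0); first exact: measurable0.
  by apply/seteqP; split=> // y /= /esym/eqP; rewrite (negbTE i0).
have mc : measurable ([set y | dist c y < e] : set (borel y0)).
  by apply: sub_sigma_algebra; exact: open_mdist.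
case: i => [|i].
  rewrite (_ : [set _ | _] = [set y | dist c y < e])//.
  by apply/seteqP; split=> y /=; case: ifP.
rewrite (_ : [set _ | _] = ~` [set y | dist c y < e] `&`
    [set y | find (fun c => dist c y < e) s = i]).
  by apply: measurableI; [exact: measurableC|exact: IH].
apply/seteqP; split=> y /=; case: ifP => [//|cy].
- by move=> [<-]; split=> //; rewrite cy.
- by move=> cy [].
- by move=> [_ ->].
Qed.

Lemma measurable_continuous_preimage (h : Y -> Y) (A : set (borel y0)) :
  continuous h -> measurable A -> measurable (h @^-1` A : set (borel y0)).
Proof.
move=> hc mA.
have mh : measurable_fun (setT : set (borel y0)) (h : borel y0 -> borel y0).
  apply: (@measurability _ _ (borel y0) (borel y0) setT h
    (@open (at_point y0)) erefl).
  move=> _ [B oB <-]; rewrite setTI; apply: sub_sigma_algebra.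
  by apply: open_comp => // y _; exact: hc.
by rewrite -[X in measurable X]setTI; exact: mh.
Qed.

(** Codes take countably many values with measurable level sets, so [P] can be arbitrary. *)
Lemma measurable_code (J : Type) (cell : J -> Y -> nat) (W : seq J)
    (P : set (seq nat)) :
  (forall j i, measurable ([set y | cell j y = i] : set (borel y0))) ->
  measurable ([set y | P [seq cell j y | j <- W]] : set (borel y0)).
Proof.
move=> mcell; elim: W P => [|j W IH] P /=.
  have [p|p] := pselect (P [::]).
    by rewrite (_ : [set _ | _] = setT); [exact: measurableT|apply/seteqP; split].
  rewrite (_ : [set _ | _] = set0); first exact: measurable0.
  by apply/seteqP; split.
rewrite (_ : [set _ | _] = \bigcup_i ([set y | cell j y = i] `&`
    [set y | P (i :: [seq cell j y | j <- W])])).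
  apply: bigcup_measurable => i _; apply: measurableI; first exact: mcell.
  exact: (IH (fun l => P (i :: l))).
apply/seteqP; split=> y /=; first by exists (cell j y).
by move=> [i _ [<-]].
Qed.

End cells.

(** * The partial cocycle at one level of the cone *)

Section stage.
Context {R : realType} {G : groupType} (S : seq G) {Y : metricType R}.
Variable act : G -> Y -> Y.
Hypotheses (hS : symmetric_generating S) (hact : is_action act)
  (hcont : forall g, continuous (act g)) (hcompact : compact [set: Y])
  (hdiam : (diam (@mdist R Y) [set: Y] <= 2%:E)%E).
Local Notation dist := (@mdist R Y).
Local Notation X := (@cone R Y).
Local Notation dG := (warped_cone_dist act S : X -> X -> R).
Context {H : hilbertType R} (L : R) (rho_m rho_p : R -> R).
Hypotheses (rho_mc : control_function rho_m) (rho_pc : control_function rho_p).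
Hypothesis emb : forall r, 0 < r -> exists2 K : set X, (diam dG K < +oo)%E &
  exists v : set X -> X -> H,
  let small C := C `<=` ~` K /\ (diam dG C < r%:E)%E in
  (forall C x y, small C -> C x -> C y ->
    rho_m (dG x y) <= `|v C x - v C y| <= rho_p (dG x y)) /\
  (forall C D, small C -> small D -> C `&` D !=set0 ->
    exists2 T : {linear H -> H}, forall h, `|T h| <= L * `|h| &
    forall x y, C x -> D x -> C y -> D y ->
      v C x - v C y = T (v D x - v D y)).

(** Levels are bounded on a bounded set, since [dG] dominates their differences. *)
Lemma level_outside (K : set X) (n : nat) : (diam dG K < +oo)%E ->
  exists2 t : {t : R | 1 <= t}, n%:R <= sval t & forall y, ~ K (t, y).
Proof.
move=> Kb; have [[p Kp]|K0] := pselect (exists p, K p); last first.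
  have t1 : 1 <= 1 + n%:R :> R by rewrite lerDl.
  exists (exist _ (1 + n%:R) t1) => /=; first by rewrite lerDr.
  by move=> y Ky; apply: K0; eexists; exact: Ky.
have diam0 : (0 <= diam dG K)%E.
  apply: (@le_trans _ _ (dG p p)%:E); last first.
    by apply: ereal_sup_ubound; exists (p, p).
  by rewrite lee_fin; have [h _ _ _] := warped_cone_metric act S hdiam; exact: h.
have d0 : 0 <= fine (diam dG K) by rewrite fine_ge0.
have p1 : 1 <= sval p.1 by case: (p.1).
have n0 : 0 <= n%:R :> R by [].
have t1 : 1 <= sval p.1 + fine (diam dG K) + n%:R + 1 by lra.
pose t : {t : R | 1 <= t} := exist (fun t => is_true (1 <= t)) _ t1.
exists t => /=; first by lra.
move=> y Ky.
have : dG (t, y) p <= fine (diam dG K).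
  rewrite -lee_fin fineK; last first.
    by rewrite ge0_fin_numE.
  by apply: ereal_sup_ubound; exists ((t, y), p).
apply/negP; rewrite -ltNge.
apply: lt_le_trans (warped_cone_dist_ge act S hdiam _ _) => /=.
by rewrite ger0_norm; lra.
Qed.

(* Trivializations depend arbitrarily on the set [C].  Points are therefore
   replaced by the centres of finitely many Borel cells, so that [b g] is a
   function of a measurable code with finitely many values. *)
Lemma stage (y0 : Y) (n : nat) :
  exists (t : {t : R | 1 <= t}) (b : G -> Y -> H) (code : Y -> seq nat),
  [/\ n%:R <= sval t,
      (forall P, measurable ([set y | P (code y)] : set (borel y0))) /\
        (forall g y y', code y = code y' -> b g y = b g y'),
      (forall y, b 1%g y = 0) /\
        (forall k g y, g \in wball S k -> `|b g y| <= `|rho_p (k%:R + 1)|),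
      forall g y, g \in wball S n ->
        exists2 T : {linear H -> H}, forall h, `|T h| <= L * `|h| &
        forall h, h \in wball S n -> (g * h)%g \in wball S n ->
          b (g * h)%g y - b g y = T (b h (act g^-1%g y)) &
      forall k g y, g \in wball S n ->
        k%:R + 1 <= dG (t, y) (t, act g^-1%g y) -> rho_m k%:R <= `|b g y|].
Proof.
(* Two points of [C y] differ by an element of length [2 * n], and replacing points by centres adds
   [1]; one more unit makes the inequality strict. *)
have [|K Kb [v [vP vT]]] := emb (r := (n + n)%:R + 2); first by rewrite ltr_wpDl.
have [t nt tK] := level_outside n Kb.
have t0 : 0 < sval t by rewrite (lt_le_trans ltr01)//; case: (t).
(* At level [t] this radius becomes [1 / 2]. *)
have e0 : 0 < (2 * sval t)^-1 by rewrite invr_gt0 mulr_gt0.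
have [s sP] := finite_net hcompact e0.
pose cell y := find (fun c => dist c y < (2 * sval t)^-1) s.
pose z y := nth y0 s (cell y).
have zP y : dist (z y) y < (2 * sval t)^-1.
  apply: (@nth_find _ y0 (fun c => dist c y < (2 * sval t)^-1)).
  by apply/hasP; have [c cs cy] := sP y; exists c.
pose P w : X := (t, z w).
have [dG0 _ dGC dGT] := warped_cone_metric act S hdiam.
have Pnear w : dG (P w) (t, w) <= 1 / 2.
  apply: le_trans (warped_dist_le _ _ (cone_dist_metric hdiam) _ _) _.
  rewrite /cone_dist /= subrr normr0 add0r minxx.
  rewrite (le_trans (ler_wpM2l (ltW t0) (ltW (zP w))))//.
  by rewrite invfM mulrCA divff ?gt_eqF// mulr1 div1r.
have Pact w g k : g \in wball S k -> dG (P w) (P (act g w)) <= k%:R + 1.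
  move=> gk.
  have h1 := dGT (P w) (t, w) (P (act g w)).
  have h2 := dGT (t, w) (t, act g w) (P (act g w)).
  have h3 : dG (t, w) (t, act g w) <= k%:R.
    exact: (warped_dist_wball (cone_dist_metric hdiam) (cone_act_action hact) (t, w) gk).
  have h4 := Pnear w; have h5 := Pnear (act g w); rewrite dGC in h5.
  by lra.
pose C y : set X := [set p | exists2 h, h \in wball S n & p = P (act h^-1%g y)].
have Cin y h : h \in wball S n -> C y (P (act h^-1%g y)) by move=> hn; exists h.
have actV g y : act g (act g^-1%g y) = y by rewrite -hact.2 mulgV hact.1.
have Cy y : C y (P y).
  by have := Cin y 1%g (wball1 S n); rewrite invg1 hact.1.
have smallC y : C y `<=` ~` K /\ (diam dG (C y) < ((n + n)%:R + 2)%:E)%E.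
  split; first by move=> _ [h _ ->]; exact: tK.
  apply: (@le_lt_trans _ _ ((n + n)%:R + 1)%:E); last by rewrite lte_fin ltrD2l ltr1n.
  apply: ge_ereal_sup => _ [[_ _] [/= [h hn ->] [h' h'n ->]] <-]; rewrite lee_fin.
  have -> : act h'^-1%g y = act (h'^-1 * h)%g (act h^-1%g y) by rewrite hact.2 actV.
  by apply: Pact; apply: wballM => //; exact: wballV.
pose b g y : H :=
  if g \in wball S n then v (C y) (P (act g^-1%g y)) - v (C y) (P y) else 0.
pose code y := [seq cell (act h^-1%g y) | h <- wball S n].
have codeE y y' : code y = code y' -> forall h, h \in wball S n ->
    P (act h^-1%g y) = P (act h^-1%g y').
  move=> /eq_in_map yy' h hn; congr (_, nth _ _ _); exact: yy'.
have codeC y y' : code y = code y' -> C y = C y'.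
  by move=> /codeE yy'; apply/seteqP; split=> _ [h hn ->]; exists h => //;
    rewrite yy'.
exists t, b, code; split=> //.
- split=> [Q|g y y' yy'].
    apply: (@measurable_code _ _ y0 _ (fun h y => cell (act h^-1%g y))) => h i.
    rewrite [X in measurable X](_ : _ = act h^-1%g @^-1` [set y | cell y = i])//.
    by apply: measurable_continuous_preimage; [exact: hcont|exact: measurable_find].
  rewrite /b (codeC _ _ yy'); case: ifP => // gn; rewrite (codeE _ _ yy' _ gn).
  have := codeE _ _ yy' 1%g (wball1 S n).
  by rewrite invg1 !hact.1 => ->.
- split=> [y|k g y gk]; first by rewrite /b wball1 invg1 hact.1 subrr.
  rewrite /b; case: ifP => gn; last by rewrite normr0.
  have /andP[_] := vP _ _ _ (smallC y) (Cin y g gn) (Cy y).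
  move=> /le_trans -> //; apply: le_trans (ler_norm _); apply: rho_pc.1 => //.
  by have := Pact (act g^-1%g y) g k gk; rewrite actV.
- move=> g y gn.
  (* Both sets contain the centres for [g^-1 y] and [(g h)^-1 y]. The first is the base point of the
     second set, so the difference read there is [b h (g^-1 y)]. *)
  have [|T TL TE] := vT _ _ (smallC y) (smallC (act g^-1%g y)).
    by exists (P (act g^-1%g y)); split; [exact: Cin|exact: Cy].
  exists T => // h hn ghn; rewrite /b gn hn ghn opprB addrA subrK.
  have ghE : act (g * h)^-1%g y = act h^-1%g (act g^-1%g y).
    by rewrite invgM hact.2.
  apply: etrans (TE _ _ (Cin _ _ ghn) _ (Cin _ _ gn) (Cy _)) _.
    by rewrite ghE; exact: Cin.
  by rewrite ghE.
(* Passing to the two centres loses at most [1 / 2] each, which the summand [1] compensates. *)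
- move=> k g y gn kd; rewrite /b gn.
  have /andP[+ _] := vP _ _ _ (smallC y) (Cin y g gn) (Cy y).
  apply: le_trans; apply: rho_mc.1 => //.
  have h1 := dGT (t, y) (P y) (t, act g^-1%g y).
  have h2 := dGT (P y) (P (act g^-1%g y)) (t, act g^-1%g y).
  have h4 := Pnear y; have h5 := Pnear (act g^-1%g y); rewrite dGC in h4.
  by rewrite dGC; lra.
Qed.

End stage.

(** * Separation of orbit points by essential freeness *)

Section separation.
Context {R : realType} {G : groupType} (S : seq G) {Y : metricType R}.
Variable act : G -> Y -> Y.
Hypotheses (hS : symmetric_generating S) (hact : is_action act)
  (hcont : forall g, continuous (act g)) (hcompact : compact [set: Y])
  (hdiam : (diam (@mdist R Y) [set: Y] <= 2%:E)%E).
Local Notation dist := (@mdist R Y).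
Local Notation X := (@cone R Y).
Local Notation dG := (warped_cone_dist act S : X -> X -> R).

Lemma generators_unif_continuous e : 0 < e -> exists2 r, 0 < r &
  forall s y z, s \in S -> dist y z <= r -> dist (act s y) (act s z) <= e.
Proof.
move=> e0; elim: S => [|s l [r r0 IH]]; first by exists 1.
have [r' r'0 sr'] := compact_unif_continuous hcompact (@hcont s) e0.
exists (Num.min r r'); first by rewrite lt_min r0.
move=> s' y z; rewrite inE le_min => /orP[/eqP -> /andP[_]|s'l /andP[+ _]].
  exact: sr'.
exact: IH.
Qed.

(** Uniform continuity of the generators carries small jumps through boundedly many moves; here [r]
    depends on [k], unlike the estimate of [reach_isometric]. *)
Lemma reach_uniform k e : 0 < e -> exists2 r, 0 < r & forall j y z,
  (j <= k)%N -> reach act S j r y z ->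
  exists2 g, g \in wball S k & dist (act g y) z <= e.
Proof.
suff reachk j : forall e, 0 < e -> exists2 r, 0 < r & forall y z,
    reach act S j r y z -> exists2 g, g \in wball S j & dist (act g y) z <= e.
  elim: k e => [|k IH] e e0.
    have [r r0 rP] := reachk 0%N e e0.
    by exists r => // j y z; rewrite leqn0 => /eqP -> yz; exact: (rP _ _ yz).
  have [r' r'0 r'P] := IH e e0; have [r2 r20 r2P] := reachk k.+1 e e0.
  exists (Num.min r' r2) => [|j y z]; first by rewrite lt_min r'0.
  rewrite leq_eqVlt => /orP[/eqP -> yz|].
    by apply: r2P (reach_sub _ yz); rewrite ge_min lexx orbT.
  rewrite ltnS => jk yz; have [|g gk gyz] := r'P j y z jk (reach_sub _ yz).
    by rewrite ge_min lexx.
  by exists g => //; apply: sub_wball gk.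
elim: j => [|j IH] {}e e0.
  exists e => // y z /= yz; exists 1%g; first exact: wball1.
  by rewrite hact.1.
have e20 : 0 < e / 2 by rewrite divr_gt0.
have [r r0 rP] := generators_unif_continuous e20.
have [r' r'0 r'P] := IH r r0.
exists (Num.min r' (e / 2)) => [|y z]; first by rewrite lt_min r'0.
move=> [u [s [b [sS yu]]]]; rewrite le_min => /andP[br' be].
have b0 := reach_ge0 yu; have suz0 := mdist_ge0 (act s u) z.
have [|g gj gyu] := r'P y u (reach_sub _ yu); first by lra.
exists (s * g)%g; first exact: wballS.
rewrite hact.2; have := rP s _ _ sS gyu.
by have := metric_triangle (act s (act g y)) (act s u) z; lra.
Qed.

Lemma level_separation k e : 0 < e -> exists T0 : R, forall t : {t : R | 1 <= t},
  T0 <= sval t -> forall y z, dG (t, y) (t, z) < k%:R ->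
  exists2 g, g \in wball S k & dist (act g y) z <= e.
Proof.
move=> e0; have [r r0 rP] := reach_uniform k e0.
(* A path of cost below [k] stays above level [k / r + 1], which forces its jumps to have total
   length at most [r]. *)
exists (k%:R + k%:R / r + 1) => t Tt y z yz.
have k0 : 0 <= k%:R / r :> R by rewrite divr_ge0// ltW.
have [||j [a [yza ja]]] := warped_cone_reach hS hact hdiam (m := k%:R / r + 1) _ _ yz.
- by lra.
- by move: Tt => /=; lra.
have a0 := reach_ge0 yza.
have j0 : 0 <= j%:R :> R by [].
have ka0 : 0 <= (k%:R / r + 1) * a by rewrite mulr_ge0// addr_ge0.
apply: (rP j _ _ _ (reach_sub _ yza)); first by rewrite -(ler_nat R); lra.
rewrite leNgt; apply/negP => ra.
have : k%:R / r * r <= k%:R / r * a by rewrite ler_wpM2l// ltW.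
by rewrite divfK ?gt_eqF//; move: ja; rewrite mulrDl mul1r; lra.
Qed.

Lemma open_dist_gt (p q : Y -> Y) e : continuous p -> continuous q ->
  open [set y | e < dist (p y) (q y)].
Proof.
move=> pc qc; suff epq_open (y : Y) : e < dist (p y) (q y) -> exists2 a, 0 < a &
    forall u, dist y u < a -> e < dist (p u) (q u).
  rewrite openE => y /= /epq_open[a a0 ya]; apply/nbhs_ballP.
  by exists a => // u; rewrite ballEmdist; exact: ya.
move=> epq; pose r := (dist (p y) (q y) - e) / 2.
have r0 : 0 < r by rewrite divr_gt0// subr_gt0.
have hp : nbhs y [set u | ball (p y) r (p u)].
  exact: (cvg_ballP _ _).1 (pc y) _ r0.
have hq : nbhs y [set u | ball (q y) r (q u)].
  exact: (cvg_ballP _ _).1 (qc y) _ r0.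
case/nbhs_ballP: hp => /= a a0 pa; case/nbhs_ballP: hq => /= b b0 qb.
exists (Num.min a b) => [|u]; first by rewrite lt_min a0.
rewrite lt_min => /andP[ua ub].
have : ball (p y) r (p u) by apply: pa; rewrite ballEmdist.
have : ball (q y) r (q u) by apply: qb; rewrite ballEmdist.
rewrite !ballEmdist /= => qu pu.
have := metric_triangle (p y) (p u) (q y); have := metric_triangle (p u) (q u) (q y).
by rewrite (metric_sym (q u) (q y)); rewrite /r in r0 pu qu *; lra.
Qed.

Lemma measurable_dist_le (y0 : Y) (p q : Y -> Y) e : continuous p -> continuous q ->
  measurable ([set y | dist (p y) (q y) <= e] : set (borel y0)).
Proof.
move=> pc qc; rewrite [X in measurable X](_ : _ = ~` [set y | e < dist (p y) (q y)]).
  by apply: measurableC; apply: sub_sigma_algebra; exact: open_dist_gt.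
by apply/seteqP; split=> y /= => [ye|/negP]; [apply/negP|]; rewrite -leNgt.
Qed.

Context (y0 : Y) (mu : probability (borel y0) R).
Hypothesis hfree : essentially_free mu act.

Lemma measurable_fixed : measurable
  ([set y | exists2 g, g != 1%g & act g y = y] : set (borel y0)).
Proof.
have [e eP] := countable_group hS.
rewrite [X in measurable X](_ : _ = \bigcup_(i in [set i | e i != 1%g])
    ([set y | dist (act (e i) y) y <= 0] : set (borel y0))).
  apply: bigcup_measurable => i _.
  by apply: (@measurable_dist_le y0 (act (e i)) id) => // y; exact: cvg_id.
apply/seteqP; split=> y /=.
  move=> [g g1 gy]; have [i ig] := eP g; exists i; first by rewrite /= ig.
  by rewrite /= ig gy mdistxx.
move=> [i /= i1 iy]; exists (e i) => //; apply: mdist_positivity.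
by apply/eqP; rewrite eq_le iy mdist_ge0.
Qed.

(** Continuity from above: as [e] tends to [0] these sets decrease to points fixed by [h^-1 * g],
    which form a null set. *)
Lemma small_coincidence g h (r : R) : g != h -> 0 < r ->
  exists2 e, 0 < e & (mu [set y | (dist (act g y) (act h y) <= e)%R] <= r%:E)%E.
Proof.
move=> gh r0.
pose F (n : nat) : set (borel y0) := [set y | dist (act g y) (act h y) <= n.+1%:R^-1].
have mF n : measurable (F n) by apply: measurable_dist_le; exact: hcont.
have mFI : measurable (\bigcap_n F n) by exact: bigcap_measurable.
have F0 : mu (\bigcap_n F n) = 0%E.
  apply/eqP; rewrite eq_le measure_ge0 andbT -hfree.
  apply: le_measure; rewrite ?inE//; first exact: measurable_fixed.
  move=> y Fy /=; exists (h^-1 * g)%g.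
    by apply: contra gh => /eqP hg; rewrite -(mulVKg h g) hg mulg1.
  rewrite hact.2 (_ : act g y = act h y) -?hact.2 ?mulVg ?hact.1//.
  apply: mdist_positivity; apply/eqP; rewrite eq_le mdist_ge0 andbT.
  apply/ler_addgt0Pl => e e0; rewrite addr0.
  have [n _ /(_ n (leqnn n))/ltW ne] := near_infty_natSinv_lt (PosNum e0).
  by apply: le_trans ne; exact: Fy.
have : mu (F n) @[n --> \oo] --> mu (\bigcap_n F n).
  apply: nonincreasing_cvg_mu => //.
    by rewrite (le_lt_trans (probability_le1 _ _))// ltry.
  move=> m n mn; apply/subsetPset => y /= /le_trans; apply.
  by rewrite lef_pV2 ?posrE// ler_nat ltnS.
rewrite F0 => /fine_cvgP[Ffin] /cvgrPdist_le/(_ _ r0)[n _ /(_ n (leqnn n)) /=].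
rewrite sub0r normrN => Fr; exists n.+1%:R^-1; first by rewrite invr_gt0.
have -> : mu (F n) = (fine (mu (F n)))%:E by rewrite fineK// fin_num_measure.
rewrite lee_fin.
exact: le_trans (ler_norm _) Fr.
Qed.

Lemma small_coincidences (W : seq G) h (r : R) : h \notin W -> 0 < r ->
  exists2 e, 0 < e & exists A : set (borel y0), [/\ measurable A, (mu A <= r%:E)%E &
    forall g y, g \in W -> dist (act g y) (act h y) <= e -> A y].
Proof.
elim: W r => [|g W IH] r hW r0.
  by exists 1 => //; exists set0; split=> //; rewrite measure0 lee_fin ltW.
move: hW; rewrite inE negb_or eq_sym => /andP[gh hW].
have r20 : 0 < r / 2 by rewrite divr_gt0.
have [e e0 [A [mA Ar AP]]] := IH _ hW r20.
have [e' e'0 e'r] := small_coincidence gh r20.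
exists (Num.min e e'); first by rewrite lt_min e0.
pose D : set (borel y0) := [set y | dist (act g y) (act h y) <= e'].
have mD : measurable D by apply: measurable_dist_le; exact: hcont.
exists (A `|` D); split; first exact: measurableU.
  apply: le_trans (measureU2 mu mA mD) _.
  by rewrite (splitr r) EFinD leeD.
move=> k y; rewrite inE le_min => /orP[/eqP -> /andP[_ ?]|kW /andP[ke _]].
  by right.
by left; exact: AP ke.
Qed.

End separation.

(** * The free vector space and its cocycle action *)

Section poly_linear.
Context {R : realType} {W : lmodType R}.
Implicit Types (x : nat -> W) (p : {poly R}).

(** Polynomials serve as the free vector space on [nat], whose elements index the group; this is the
    universal property, sending ['X^i] to [x i]. *)
Definition poly_lin x p : W := \sum_(i < size p) p`_i *: x i.

Lemma poly_lin_widen x p n : (size p <= n)%N ->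
  poly_lin x p = \sum_(i < n) p`_i *: x i.
Proof.
move=> pn; rewrite /poly_lin (big_ord_widen n (fun i => p`_i *: x i) pn).
rewrite big_mkcond; apply: eq_bigr => i _; case: ltnP => // pi.
by rewrite nth_default// scale0r.
Qed.

Lemma poly_lin_is_linear x : linear (poly_lin x).
Proof.
move=> a p q; set n := maxn (size (a *: p + q)) (maxn (size p) (size q)).
rewrite !(@poly_lin_widen _ _ n) ?leq_max ?leqnn ?orbT//.
rewrite scaler_sumr -big_split; apply: eq_bigr => i _ /=.
by rewrite coefD coefZ scalerDl scalerA.
Qed.

HB.instance Definition _ x :=
  GRing.isLinear.Build R {poly R} W *:%R (poly_lin x) (poly_lin_is_linear x).

Lemma poly_linXn x k : poly_lin x 'X^k = x k.
Proof.
rewrite /poly_lin size_polyXn big_ord_recr /= coefXn eqxx scale1r big1 ?add0r//.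
by move=> i _; rewrite coefXn ltn_eqF// scale0r.
Qed.

Lemma linear_poly_lin (A : {linear {poly R} -> W}) p :
  A p = poly_lin (fun i => A 'X^i) p.
Proof.
rewrite -{1}(coefK p) poly_def raddf_sum; apply: eq_bigr => i _ /=.
by rewrite linearZ.
Qed.

Lemma eq_linear_poly (A A' : {linear {poly R} -> W}) :
  (forall i, A 'X^i = A' 'X^i) -> A =1 A'.
Proof.
move=> AA' p; rewrite (linear_poly_lin A p) (linear_poly_lin A' p); apply: eq_bigr => i _.
by rewrite AA'.
Qed.

End poly_linear.

Lemma linear_poly_lin_comp (R : realType) (V W : lmodType R)
    (A : {linear V -> W}) (x : nat -> V) (p : {poly R}) :
  A (poly_lin x p) = poly_lin (fun i => A (x i)) p.
Proof. by rewrite raddf_sum; apply: eq_bigr => i _ /=; rewrite linearZ. Qed.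

Lemma seminorm_poly_lin_eq0 (R : realType) (V : lmodType R) (B : semi_inner V)
    (x : nat -> V) (p : {poly R}) :
  (forall i, seminorm B (x i) = 0) -> seminorm B (poly_lin x p) = 0.
Proof.
move=> x0; apply/eqP; rewrite eq_le seminorm_ge0 andbT /poly_lin.
elim/big_ind : _ => [|v w v0 w0|i _]; first by rewrite seminorm0.
  by apply: le_trans (seminormD _ _ _) _; lra.
by rewrite seminormZ x0 mulr0.
Qed.

Section kernel_action.
Context {R : realType} {G : groupType}.
Variables (e : nat -> G) (idx : G -> nat).
Hypothesis eK : forall g, e (idx g) = g.
Local Notation V := {poly R}.

(* The monomial ['X^i] stands for the value at [e i] of a cocycle [b], and the
   linear part of the action is forced by [pi g (b h) = b (g h) - b g]. *)
Definition cocycle_lin (g : G) : {linear V -> V} :=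
  poly_lin (fun i => 'X^(idx (g * e i)%g) - 'X^(idx g)).

Lemma cocycle_linXn g i :
  cocycle_lin g 'X^i = 'X^(idx (g * e i)%g) - 'X^(idx g).
Proof. exact: poly_linXn. Qed.

Lemma cocycle_linM g h p :
  cocycle_lin (g * h)%g p = cocycle_lin g (cocycle_lin h p).
Proof.
apply: (@eq_linear_poly _ _ _ (cocycle_lin g \o cocycle_lin h)) => i /=.
by rewrite !cocycle_linXn raddfB /= !cocycle_linXn !eK mulgA opprB addrA subrK.
Qed.

(** Since [e] may repeat elements, [cocycle_lin 1] sends ['X^i] to ['X^(idx (e i)) - 'X^(idx 1)];
    the two null conditions make it the identity on the completion. *)
Lemma kernel_action (B : semi_inner V) (L : R) : 0 < L ->
  (forall g p, B (cocycle_lin g p) (cocycle_lin g p) <= L ^+ 2 * B p p) ->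
  seminorm B 'X^(idx 1%g) = 0 ->
  (forall i, seminorm B ('X^(idx (e i)) - 'X^i) = 0) ->
  (forall M, finite_set [set g | B 'X^(idx g) 'X^(idx g) <= M]) ->
  ub_aTmenable R G.
Proof.
move=> L0 BL B1 Be BP.
have [g p|p|g h p|g h|alpha [alphaE alphaM alphaL alphaV]] :=
  @affine_action_extension _ _ B G cocycle_lin (fun g => 'X^(idx g)) L (ltW L0).
- by rewrite seminorm_le ?mulr_ge0 ?seminorm_ge0 ?(ltW L0)//
    exprMn sqr_seminorm.
- have pE : p = poly_lin (fun i => 'X^i) p by exact: (linear_poly_lin idfun p).
  have -> : cocycle_lin 1%g p - p = poly_lin (fun i =>
      'X^(idx (1 * e i)%g) - 'X^(idx 1%g) - 'X^i) p.
    rewrite [X in _ - X]pE /cocycle_lin /= /poly_lin -sumrB.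
    by apply: eq_bigr => i _; rewrite -scalerBr.
  apply: seminorm_poly_lin_eq0 => i.
  rewrite mul1g addrAC; apply/eqP; rewrite eq_le seminorm_ge0 andbT.
  by rewrite (le_trans (seminormD _ _ _))// Be seminormN B1 addr0.
- by rewrite cocycle_linM subrr seminorm0.
- by rewrite cocycle_linXn eK subrK subrr seminorm0.
have L_ge0 := ltW L0.
have aL g : (affine_norm (alpha g) <= L%:E)%E.
  exact: ((affine_iso_boundedP _ _).1 (alphaL g)).1.
exists (completion B), alpha; split.
- apply: (separable_completion (a := fun i : nat => 'X^i)) => p r r0.
  exists [seq (p`_i, i) | i <- iota 0 (size p)].
  rewrite /lincomb big_map /=.
  rewrite -{1}(coefK p) poly_def.
  rewrite (_ : \sum_(i < size p) _ = \sum_(i <- iota 0 (size p)) p`_i *: 'X^i).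
    by rewrite subrr seminorm0 ltW.
  by rewrite -(big_mkord xpredT (fun i => p`_i *: 'X^i)) /index_iota subn0.
- exact: alphaM.
- by exists L.
- move=> D [M [_ DM]]; have {DM}DM v : D v -> `|v| <= M + 1.
    by move=> Dv; apply: (DM (M + 1)) => //; rewrite ltrDl.
  (* If [v] and [alpha g v] lie in [D], then [alpha g 0], the difference of [alpha g v] and the
     linear part at [v], has norm at most this unsquared bound. *)
  apply: sub_finite_set (BP ((M + 1 + L * (M + 1)) ^+ 2)) => g [w [[v Dv <-] Dw]] /=.
  have M0 : 0 <= M + 1 := le_trans (normr_ge0 _) (DM _ Dv).
  have M1 : 0 <= L * (M + 1) by rewrite mulr_ge0.
  rewrite -sqr_seminorm ler_sqr ?nnegrE ?seminorm_ge0 ?(addr_ge0 M0 M1)//.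
  have -> : seminorm B 'X^(idx g) = `|alpha g v - affine_lin (alpha g) v|.
    have a0 : alpha g 0 = cemb B 'X^(idx g).
      by have := alphaE g 0; rewrite [cemb B 0]raddf0 [cocycle_lin g 0]raddf0 add0r.
    rewrite [alpha g v]/affine_fun addrAC subrr add0r -normr_cemb -a0.
    by rewrite /affine_fun raddf0 add0r.
  rewrite (le_trans (ler_normB _ _))// lerD ?DM//.
  by rewrite (le_trans (opnormP (aL g) _))// ler_pM2l ?DM.
Qed.

End kernel_action.

(** * Ultralimits and means over the space *)

Section ultralimit.
Context {R : realType} (U : set_system nat).
Hypothesis UU : UltraFilter U.
Implicit Types u v : nat -> R.

(** The compact segment contains a cluster point, and an ultrafilter converges to each of its
    cluster points. *)
Lemma ultralimit u (M : R) : (forall n, `|u n| <= M) ->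
  u n @[n --> U] --> lim (u n @[n --> U]).
Proof.
move=> uM; have UP : ProperFilter U := ultra_proper.
have [|p [_ up]] := @segment_compact R (- M) M (u n @[n --> U]) _.
  change (U [set n | `[- M, M]%classic (u n)]); apply: filterE => n /=.
  by rewrite in_itv /= -ler_norml.
suff : cvg (u n @[n --> U]) by [].
apply/cvg_ex; exists p => A pA; have [//|uA] := in_ultra_setVsetC (u @^-1` A) UU.
have uA' : (u n @[n --> U]) (~` A) by exact: uA.
by have [x []] := up _ _ uA' pA.
Qed.

End ultralimit.

Section mean.
Context {R : realType} {Y : metricType R} (y0 : Y) (mu : probability (borel y0) R).

Definition bounded_measurable (F : Y -> R) : Prop :=
  measurable_fun (setT : set (borel y0)) (F : borel y0 -> R) /\
  exists M, forall y, `|F y| <= M.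

Lemma bounded_measurable_code (code : Y -> seq nat) (F : Y -> R) M :
  (forall P, measurable ([set y | P (code y)] : set (borel y0))) ->
  (forall y y', code y = code y' -> F y = F y') -> (forall y, `|F y| <= M) ->
  bounded_measurable F.
Proof.
move=> mcode Fcode FM; split; last by exists M.
move=> _ A mA; rewrite setTI.
rewrite (_ : _ @^-1` _ = [set y | (exists2 y', code y' = code y & A (F y'))]).
  exact: (mcode (fun l => exists2 y', code y' = l & A (F y'))).
apply/seteqP; split=> y /= => [Ay|[y' /Fcode <- //]]; first by exists y.
Qed.

Lemma bounded_measurable_comp F (h : Y -> Y) : bounded_measurable F ->
  continuous h -> bounded_measurable (fun y => F (h y)).
Proof.
move=> [mF [M FM]] hc; split; last by exists M.
move=> _ A mA; rewrite setTI -[X in measurable X]/(h @^-1` (F @^-1` A)).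
apply: measurable_continuous_preimage => //.
by rewrite -[X in measurable X]setTI; exact: mF.
Qed.

Lemma bounded_measurableZ a F : bounded_measurable F ->
  bounded_measurable (fun y => a * F y).
Proof.
move=> [mF [M FM]]; split; first exact: measurable_funM.
by exists (`|a| * M) => y; rewrite normrM ler_wpM2l.
Qed.

Lemma bounded_measurable_cst c : bounded_measurable (fun=> c).
Proof. by split=> //; exists `|c|. Qed.

Lemma bounded_measurable_integrable F : bounded_measurable F ->
  mu.-integrable (setT : set (borel y0)) (EFin \o (F : borel y0 -> R)).
Proof.
move=> [mF [M FM]]; apply: measurable_bounded_integrable => //.
- by rewrite (le_lt_trans (probability_le1 _ _))// ltry.
- exists M; split; first exact: num_real.
  by move=> x /ltW Mx y _ /=; exact: le_trans (FM y) Mx.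
Qed.

Definition mean (F : Y -> R) : R := \int[mu]_(y in (setT : set (borel y0))) F y.

Lemma meanD F F' : bounded_measurable F -> bounded_measurable F' ->
  mean (fun y => F y + F' y) = mean F + mean F'.
Proof. by move=> hF hF'; apply: RintegralD => //; exact: bounded_measurable_integrable. Qed.

Lemma meanZ a F : bounded_measurable F -> mean (fun y => a * F y) = a * mean F.
Proof. by move=> hF; apply: RintegralZl => //; exact: bounded_measurable_integrable. Qed.

Lemma mean_ge0 F : (forall y, 0 <= F y) -> 0 <= mean F.
Proof. by move=> F0; exact: Rintegral_ge0. Qed.

Lemma mean_norm_le F M : bounded_measurable F -> (forall y, `|F y| <= M) ->
  `|mean F| <= M.
Proof.
move=> hF FM; have iF := bounded_measurable_integrable hF.
apply: le_trans (le_normr_Rintegral _ _) _ => //.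
apply: (@le_trans _ _ (mean (fun _ => M))).
  apply: le_Rintegral => //; first exact: integrable_norm.
  exact/bounded_measurable_integrable/bounded_measurable_cst.
by rewrite /mean Rintegral_cst// [X in fine X](probability_setT mu) mulr1.
Qed.

Lemma mean_le F F' : bounded_measurable F -> bounded_measurable F' ->
  (forall y, F y <= F' y) -> mean F <= mean F'.
Proof.
by move=> hF hF' FF'; apply: le_Rintegral => //; exact: bounded_measurable_integrable.
Qed.

Lemma mean_ge_setC F (A : set (borel y0)) c : bounded_measurable F -> measurable A ->
  (mu A <= (1 / 2)%:E)%E -> 0 <= c -> (forall y, 0 <= F y) ->
  (forall y, ~ A y -> c <= F y) -> c / 2 <= mean F.
Proof.
move=> hF mA Ahalf c0 F0 cF.
have mC : measurable (~` A) by exact: measurableC.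
have iC : mu.-integrable (setT : set (borel y0)) (EFin \o (\1_(~` A) : borel y0 -> R)).
  exact: integrable_indic.
apply: (@le_trans _ _ (\int[mu]_(y in (setT : set (borel y0))) (c * \1_(~` A) y))).
  rewrite RintegralZl// ler_wpM2l// /Rintegral integral_indic// setIT.
  rewrite [X in fine X](probability_setC mu)//.
  have Afin : mu A = (fine (mu A))%:E by rewrite fineK// fin_num_measure.
  move: Ahalf; rewrite Afin lee_fin -EFinB /=.
  by lra.
apply: le_Rintegral => //.
- by have := integrableZl (measurableT) c iC.
- exact: bounded_measurable_integrable.
- move=> y _; rewrite indicE; case: (pselect (A y)) => Ay.
    by rewrite memNset ?mulr0//=; apply.
  by rewrite mem_set// mulr1 cF.
Qed.

Lemma mean_invariant F (h : Y -> Y) : bounded_measurable F -> continuous h ->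
  (forall A : set (borel y0), measurable A -> mu (h @^-1` A) = mu A) ->
  (forall y, 0 <= F y) ->
  mean (fun y => F (h y)) = mean F.
Proof.
move=> hF hc hinv F0.
have mh : measurable_fun (setT : set (borel y0)) (h : borel y0 -> borel y0).
  by move=> _ A mA; rewrite setTI; exact: measurable_continuous_preimage.
have mF : measurable_fun (setT : set (borel y0)) (fun y : borel y0 => (F y)%:E).
  by apply/measurable_EFinP; have [] := hF.
have := @ge0_integral_pushforward _ _ (borel y0) (borel y0) R h mh mu setT
  (fun y => (F y)%:E) measurableT mF (fun y _ => F0 y).
rewrite preimage_setT /mean /Rintegral => <-; congr fine.
by apply: eq_measure_integral => A mA _; exact: hinv.
Qed.

End mean.

(** * The limit form and its properness *)

Section limit_action.
Context {R : realType} {G : groupType} (S : seq G) {Y : metricType R}.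
Variable act : G -> Y -> Y.
Hypotheses (hS : symmetric_generating S) (hact : is_action act)
  (hcont : forall g, continuous (act g)) (hcompact : compact [set: Y])
  (hdiam : (diam (@mdist R Y) [set: Y] <= 2%:E)%E).
Local Notation X := (@cone R Y).
Local Notation dG := (warped_cone_dist act S : X -> X -> R).
Variables (y0 : Y) (mu : probability (borel y0) R).
Hypotheses (hinv : invariant_measure act mu) (hfree : essentially_free mu act).
Context {H : hilbertType R} (L : R) (rho_m bound : R -> R).
Hypotheses (L0 : 0 < L) (rho_mc : control_function rho_m).
Variables (t : nat -> {t : R | 1 <= t}) (b : nat -> G -> Y -> H)
  (code : nat -> Y -> seq nat).
Hypotheses (nt : forall n, n%:R <= sval (t n))
  (mcode : forall n P, measurable ([set y | P (code n y)] : set (borel y0)))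
  (b_code : forall n g y y', code n y = code n y' -> b n g y = b n g y')
  (b1 : forall n y, b n 1%g y = 0)
  (b_le : forall n k g y, g \in wball S k -> `|b n g y| <= bound k%:R)
  (b_shift : forall n g y, g \in wball S n ->
    exists2 T : {linear H -> H}, forall h, `|T h| <= L * `|h| &
    forall h, h \in wball S n -> (g * h)%g \in wball S n ->
      b n (g * h)%g y - b n g y = T (b n h (act g^-1%g y)))
  (b_ge : forall n k g y, g \in wball S n ->
    k%:R + 1 <= dG (t n, y) (t n, act g^-1%g y) -> rho_m k%:R <= `|b n g y|).
Variables (e : nat -> G) (idx : G -> nat).
Hypothesis eK : forall g, e (idx g) = g.
Variables (U : set_system nat).
Hypotheses (UU : UltraFilter U) (U_oo : \oo `<=` U).

Let UP : ProperFilter U := ultra_proper.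

Let beta n (p : {poly R}) (y : Y) : H := poly_lin (fun i => b n (e i) y) p.

(** Uniformity in [n] comes from the lengths of the [e i], which do not depend on the stage; it
    makes the ultralimits exist. *)
Let beta_bound (p : {poly R}) : exists M, forall n y, `|beta n p y| <= M.
Proof.
have [k kP] := choice (fun i => wball_exists hS (e i)).
exists (\sum_(i < size p) `|p`_i| * bound (k i)%:R) => n y.
rewrite /beta /poly_lin (le_trans (ler_norm_sum _ _ _))// ler_sum// => i _.
by rewrite normrZ ler_wpM2l// b_le.
Qed.

Let inner_le (x y : H) : `|inner x y| <= `|x| * `|y|.
Proof.
by have := form_cauchy_schwarz (@inner_form R H) x y; rewrite !seminorm_inner.
Qed.

Let F n (p q : {poly R}) (y : Y) : R := inner (beta n p y) (beta n q y).

Let F_bound p q : exists M, forall n y, `|F n p q y| <= M.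
Proof.
have [M pM] := beta_bound p; have [N qN] := beta_bound q.
by exists (M * N) => n y; rewrite (le_trans (inner_le _ _))// ler_pM.
Qed.

Let F_meas n p q : bounded_measurable y0 (F n p q).
Proof.
have [M pqM] := F_bound p q.
apply: (bounded_measurable_code (@mcode n) _ (pqM n)) => y y' yy'.
by rewrite /F /beta; congr inner; apply: eq_bigr => i _; rewrite (b_code _ yy').
Qed.

Let K n p q : R := mean mu (F n p q).

Let B p q : R := lim (K n p q @[n --> U]).

Let K_cvg p q : K n p q @[n --> U] --> B p q.
Proof.
have [M pqM] := F_bound p q; apply: (@ultralimit _ _ UU _ M) => n.
by apply: mean_norm_le => //; exact: F_meas.
Qed.

Let BC p q : B p q = B q p.
Proof.
rewrite /B (_ : (fun n => K n p q) = (fun n => K n q p))//.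
apply/funext => n; rewrite /K (_ : F n p q = F n q p)//.
by apply/funext => y; exact: innerC.
Qed.

Let BDl p q r : B (p + q) r = B p r + B q r.
Proof.
apply: (@cvg_unique _ (@Rhausdorff R) (K n (p + q) r @[n --> U])); first exact: K_cvg.
rewrite (_ : (fun n => _) = (fun n => K n p r + K n q r)); last first.
  apply/funext => n; rewrite /K -meanD//.
  congr (mean mu _); apply/funext => y; rewrite /F.
  by rewrite [beta n (p + q) y]raddfD innerDl.
by apply: cvgD; exact: K_cvg.
Qed.

Let BZl a p q : B (a *: p) q = a * B p q.
Proof.
apply: (@cvg_unique _ (@Rhausdorff R) (K n (a *: p) q @[n --> U])); first exact: K_cvg.
rewrite (_ : (fun n => _) = (fun n => a * K n p q)); last first.
  apply/funext => n; rewrite /K -meanZ//.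
  congr (mean mu _); apply/funext => y; rewrite /F.
  by rewrite [beta n (a *: p) y]linearZ innerZl.
by apply: cvgMl_tmp; exact: K_cvg.
Qed.

Let K_ge0 n p : 0 <= K n p p.
Proof. by apply: mean_ge0 => y; exact: inner_ge0. Qed.

Let B_ge p M : (\forall n \near \oo, M <= K n p p) -> M <= B p p.
Proof.
move=> MK; apply: (@ler_cvg_to nat U UP R (fun=> M) (fun n => K n p p) M (B p p)).
- exact: cvg_cst.
- exact: K_cvg.
- exact: U_oo.
Qed.

Let B_ge0 p : 0 <= B p p.
Proof. by apply: B_ge; apply: nearW => n; exact: K_ge0. Qed.

Let form : semi_inner {poly R} := SemiInner BC BDl BZl B_ge0.

Let FE n p y : F n p p y = `|beta n p y| ^+ 2.
Proof. by rewrite norm_inner. Qed.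

Let form_null p : (forall n y, beta n p y = 0) -> seminorm form p = 0.
Proof.
move=> p0; rewrite /seminorm (_ : form p p = 0) ?sqrtr0//.
rewrite [LHS]/(B p p) /B (_ : (fun n => K n p p) = (fun=> 0)).
  by apply: cvg_lim; [exact: Rhausdorff|exact: cvg_cst].
apply/funext => n; rewrite /K (_ : F n p p = fun=> 0); last first.
  by apply/funext => y; rewrite FE p0 normr0 expr0n.
by rewrite /mean Rintegral_cst// mul0r.
Qed.

Let near_wball g : \forall n \near \oo, g \in wball S n.
Proof.
have [k gk] := wball_exists hS g; exists k => // n /= kn.
exact: sub_wball gk.
Qed.

Let beta_cocycle n g p y : beta n (cocycle_lin e idx g p) y =
  poly_lin (fun i => b n (g * e i)%g y - b n g y) p.
Proof.
rewrite /beta [LHS](linear_poly_lin_comp (poly_lin (fun i => b n (e i) y))).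
apply: eq_bigr => i _; congr (_ *: _).
by rewrite raddfB /= !poly_linXn !eK.
Qed.

Let form_cocycle g p :
  form (cocycle_lin e idx g p) (cocycle_lin e idx g p) <= L ^+ 2 * form p p.
Proof.
apply: (@ler_cvg_to nat U UP R
  (fun n => K n (cocycle_lin e idx g p) (cocycle_lin e idx g p))
  (fun n => L ^+ 2 * K n p p) _ (L ^+ 2 * B p p)).
- exact: K_cvg.
- by apply: cvgMl_tmp; exact: K_cvg.
apply: U_oo.
(* The partial action is defined only within the ball of radius [n]; finitely many exponents occur
   in [p], so large stages contain them all. *)
have hall : \forall n \near \oo, forall i, (i < size p)%N ->
    e i \in wball S n /\ (g * e i)%g \in wball S n.
  elim: (size p) => [|m IH]; first by apply: nearW => n i; rewrite ltn0.
  have h1 := near_wball (e m); have h2 := near_wball (g * e m)%g.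
  apply: filterS (filterI IH (filterI h1 h2)) => n [IHn [em gem]] i.
  by rewrite ltnS leq_eqVlt => /orP[/eqP -> //|]; exact: IHn.
near=> n.
have gn : g \in wball S n by near: n; exact: near_wball.
have in_ball : forall i, (i < size p)%N ->
    e i \in wball S n /\ (g * e i)%g \in wball S n by near: n.
have ginv : continuous (act g^-1%g) by exact: hcont.
rewrite /K -(mean_invariant (F_meas n p p) ginv); last first.
- by move=> y; rewrite FE sqr_ge0.
- by move=> A mA; exact: hinv.
have F'meas := bounded_measurable_comp (F_meas n p p) ginv.
rewrite -(meanZ _ _ F'meas); apply: mean_le => //.
  exact: bounded_measurableZ.
move=> y; rewrite !FE -exprMn ler_sqr ?nnegrE ?mulr_ge0 ?(ltW L0)//.
have [T TL TE] := b_shift y gn.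
rewrite beta_cocycle (_ : poly_lin _ p = T (beta n p (act g^-1%g y)))//.
rewrite linear_poly_lin_comp; apply: eq_bigr => i _; congr (_ *: _).
by have [ein gein] := in_ball i (ltn_ord i); exact: TE.
Unshelve. all: by end_near. Qed.

(** For [g] outside the ball of radius [k + 1], off a set of measure at most [1 / 2] no element of
    that ball brings [y] near [g^-1 y]. At high levels these points are then [k + 1] apart, so the
    form is at least [rho_m k ^+ 2 / 2]. *)
Let form_proper M : finite_set [set g | form 'X^(idx g) 'X^(idx g) <= M].
Proof.
(* Half of the square of [2 * (|M| + 1)] exceeds [M]. *)
have [k kM] : exists k : nat, 2 * (`|M| + 1) <= rho_m k%:R.
  have [_ /cvgryPge/(_ (2 * (`|M| + 1)))[a [_ aP]]] := rho_mc.
  exists (Num.truncn a).+1; apply: aP; exact: truncnS_gt.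
apply: (@finite_group_set _ S _ k.+1) => g gM; apply: contrapT => /negP gk.
have gVk : g^-1%g \notin wball S k.+1.
  by apply: contra gk => /(wballV hS); rewrite invgK.
have half0 : 0 < 1 / 2 :> R by [].
have [eps eps0 [A [mA Ahalf AP]]] :=
  small_coincidences hS hact hcont hfree gVk half0.
have [T0 T0P] := level_separation hS hact hcont hcompact hdiam k.+1 eps0.
have M1 : 0 < `|M| + 1 by rewrite ltr_wpDl.
have : rho_m k%:R ^+ 2 / 2 <= form 'X^(idx g) 'X^(idx g).
  apply: B_ge; near=> n.
  have gn : g \in wball S n by near: n; exact: near_wball.
  have nT : T0 <= sval (t n).
    by apply: le_trans (nt n); near: n; exact: nbhs_infty_ger.
  apply: (mean_ge_setC (F_meas n _ _) mA Ahalf); first exact: sqr_ge0.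
    by move=> y; rewrite FE sqr_ge0.
  move=> y nAy; rewrite FE ler_sqr ?nnegrE//; last first.
    by apply: le_trans kM; rewrite mulr_ge0// ltW.
  rewrite /beta poly_linXn eK; apply: b_ge => //.
  rewrite natr1 leNgt; apply/negP => /(T0P _ nT)[h hk hy].
  by apply: nAy; exact: AP hk hy.
apply/negP; rewrite -ltNge; apply: le_lt_trans gM _.
have : (2 * (`|M| + 1)) ^+ 2 <= rho_m k%:R ^+ 2.
  by rewrite ler_sqr ?nnegrE ?mulr_ge0 ?(ltW M1)// (le_trans _ kM)// mulr_ge0// ltW.
have := ler_norm M; have : 0 <= `|M| ^+ 2 := sqr_ge0 _; have := normr_ge0 M.
by rewrite !expr2; lra.
Unshelve. all: by end_near. Qed.

Lemma limit_action : ub_aTmenable R G.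
Proof.
apply: (kernel_action eK (B := form) L0) => [g p||i|M].
- exact: form_cocycle.
- by apply: form_null => n y; rewrite /beta poly_linXn eK.
- by apply: form_null => n y; rewrite /beta raddfB /= !poly_linXn eK subrr.
- exact: form_proper.
Qed.

End limit_action.

Theorem theorem1p2 (R : realType) (G : groupType) (S : seq G)
    (Y : metricType R) (act : G -> Y -> Y)
    (hS : symmetric_generating S)
    (hact : is_action act)
    (hcont : forall g, continuous (act g))
    (hcompact : compact [set: Y])
    (hdiam : (diam (@mdist R Y) [set: Y] <= 2%:E)%E) :
  (free_action act ->
   (exists E : hilbertType R, linearizable act E) ->
   ub_aTmenable R G ->
   ub_fibred_coarse_embedding (warped_cone_dist act S)) /\
  (forall (y0 : Y) (mu : probability (borel y0) R),
   invariant_measure act mu ->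
   essentially_free mu act ->
   ub_fibred_coarse_embedding (warped_cone_dist act S) ->
   ub_aTmenable R G).
Proof.
split=> [hfree [E [pi [f [c [C [pi_rep c0 fbi f_equiv]]]]]]|y0 mu hinv hfree].
  move=> [H0 [alpha [hsep alphaM [L0 L00 alphaL] alphaP]]].
  (* The upper constant [C] carries no sign, for instance when [Y] is a single point. *)
  have C1 : 0 < `|C| + 1 by rewrite ltr_wpDl.
  have f_le y z : `|f y - f z| <= (`|C| + 1) * mdist y z.
    have /andP[_ /le_trans] := fbi y z; apply.
    by rewrite ler_wpM2r ?mdist_ge0// (le_trans (ler_norm C))// lerDl.
  have f_ge y z : c * mdist y z <= `|f y - f z| by have /andP[] := fbi y z.
  have f_cont : continuous (fun y => `|f y|).
    move=> y; apply/cvg_ballP => r r0; apply/nbhs_ballP.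
    exists (r / (`|C| + 1)) => /=; first by rewrite divr_gt0.
    move=> z; rewrite ballEmdist /= ltr_pdivlMr// mulrC => yz.
    rewrite /ball /= (le_lt_trans (ler_dist_dist _ _))//.
    exact: le_lt_trans (f_le _ _) yz.
  have [M fM] := compact_bounded_real hcompact f_cont.
  exact: (fibred_embedding hS hact hcont hcompact hdiam hfree pi_rep f_equiv
    c0 C1 fM f_ge f_le alphaM L00 alphaL alphaP hsep).
move=> /trivialised_section[H [L [rho_m [rho_p [L0 rho_mc rho_pc emb]]]]].
have /choice[t] := stage hS hact hcont hcompact hdiam rho_mc rho_pc emb y0.
move=> /choice[b /choice[code stageP]].
have [e /choice[idx eK]] := countable_group hS.
have [U [UU U_oo]] := ultraFilterLemma (eventually_filter : ProperFilter \oo).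
apply: (@limit_action _ _ S _ act hS hact hcont hcompact hdiam y0 mu hinv hfree
  H L rho_m (fun k => `|rho_p (k + 1)|) L0 rho_mc t b code _ _ _ _ _ _ _
  e idx eK U UU U_oo).
- by move=> n; have [] := stageP n.
- by move=> n; have [_ []] := stageP n.
- by move=> n g y y'; have [_ [_ h] _ _ _] := stageP n; exact: h.
- by move=> n y; have [_ _ [h _] _ _] := stageP n; exact: h.
- by move=> n k g y; have [_ _ [_ h] _ _] := stageP n; exact: h.
- by move=> n; have [] := stageP n.
- by move=> n; have [] := stageP n.
Qed.
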